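(* Suppose $G$ has the form (PL), $G(\cdot,z)$ is lower semicontinuous for every $z\in\mathbb R^d$, and $\Lambda_i(Z_1)\in H^{\Phi^*}$ for $i=1,\dots,r$. Then (A1), (A2), (A3) hold. If in addition $\Phi^*(|\Lambda_i(Z_1)|+\eta)$ is square integrable for all $i=1,\dots,r$ and $\eta>0$, then (A4) holds and (A5) holds with $\bar d=\bar d_{\mathbb P,2}$, where $\bar d_{\mathbb P,2}((\theta,x),(\vartheta,y)):=\|h_{(\theta,x)}-h_{(\vartheta,y)}\|_{L^2(\mathbb P^Z)}$.
   Context: Setup: $Z_1,Z_2,\dots$ i.i.d. $\mathbb R^d$-valued random vectors with law $\mathbb P^Z$; $\Theta\subseteq\mathbb R^m$ nonempty compact; $\Phi:[0,\infty[\to[0,\infty]$ lower semicontinuous convex, $\Phi(0)<\infty$, $\Phi(x_0)<\infty$ for some $x_0>1$, $\inf\Phi=0$, $\Phi(x)/x\to\infty$; $\Phi^*(y)=\sup_{x\ge0}(xy-\Phi(x))$; $H^{\Phi^*}=\{X:\mathbb E[\Phi^*(c|X|)]<\infty\ \forall c>0\}$. $h_{(\theta,x)}(z)=\Phi^*(G(\theta,z)+x)$; $(\mathbb P_n-\mathbb P)(h)=\frac1n\sum_{j\le n}(h(Z_j)-\mathbb E h(Z_j))$. (PL): $G(\theta,z)=\sum_{i=1}^r\big(\min_{l\le s_i}\mathbb 1_{I_{il}}(L^i_l(T(\theta)+z)+a^i_l)\big)(\Lambda_i(T(\theta)+z)+b_i)$ with $r,s_i\in\mathbb N$, $a^i_l,b_i\in\mathbb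 R$, $\Lambda_i,L^i_l:\mathbb R^d\to\mathbb R$ and $T:\mathbb R^m\to\mathbb R^d$ linear, $]0,\infty[\subseteq I_{il}\subseteq[0,\infty[$, the $r$ min-indicator factors pairwise having zero product and summing to $1$ for all $(\theta,z)$. (A1) $G$ is $\mathcal B(\Theta)\otimes\mathcal B(\mathbb R^d)$-measurable and $G(\cdot,z)$ lower semicontinuous. (A2) $\sup_\theta|G(\theta,z)|\le\xi_1(z)$ for some $\mathbb P^Z$-integrable $\xi_1$. (A3) $G(\theta,Z_1)\in H^{\Phi^*}$ for all $\theta$ and $\sup_\theta|\Phi^*(G(\theta,z))|\le\xi_2(z)$ for some $\mathbb P^Z$-integrable $\xi_2$. (A4) $\Phi^*(G(\theta,Z_1)+x)$ square integrable for all $(\theta,x)$, $\sup_{\theta,|x|\le k}\mathbb E[\Phi^*(G(\theta,Z_1)+x)]<\infty$ for all $k$. (A5) for the semimetric $\bar d$, totally bounded on each $\Theta\times[-k,k]$: for all $\varepsilon>0,k\in\mathbb N$, $\lim_{\delta\to0+}\limsup_n\mathbb P^*(\sup_{\gamma_1,\gamma_2\in\Theta\times[-k,k],\bar d(\gamma_1,\gamma_2)<\delta}\sqrt n|(\mathbb P_n-\mathbb P)(h_{\gamma_1}-h_{\gamma_2})|>\varepsilon)=0$. *)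

(* Defs.v *)
From HB Require Import structures.
From mathcomp Require Import all_boot all_order all_algebra.
From mathcomp Require Import all_classical all_reals all_analysis.

(* no implicit-argument inference: families like L i l must stay explicit *)
Unset Strict Implicit.
Unset Printing Implicit Defensive.

Import Order.TTheory GRing.Theory Num.Theory.
Import numFieldNormedType.Exports.
Local Open Scope classical_set_scope.
Local Open Scope ring_scope.

Definition Rvec (R : realType) (n : nat) :=
  g_sigma_algebraType (@open 'rV[R]_n).

Section Defs.
Context {R : realType}.

Definition linear_map {p q : nat} (f : 'rV[R]_p -> 'rV[R]_q) :=
  forall (c : R) (u v : 'rV[R]_p), f (c *: u + v) = c *: f u + f v.
Definition linear_functional {p : nat} (f : 'rV[R]_p -> R) :=
  forall (c : R) (u v : 'rV[R]_p), f (c *: u + v) = c * f u + f v.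

(* Only the values of Phi on [0, +oo[ matter. *)
Definition Phi_admissible (Phi : R -> \bar R) : Prop :=
  (forall x, 0 <= x -> (0 <= Phi x)%E) /\
  (forall x, 0 <= x -> forall t : R, (t%:E < Phi x)%E ->
      \forall y \near x, 0 <= y -> (t%:E < Phi y)%E) /\
  (forall x y l : R, (0 <= x)%R -> (0 <= y)%R -> (0 <= l)%R -> (l <= 1)%R ->
      (Phi (l * x + (1 - l) * y)%R <= l%:E * Phi x + (1 - l)%R%:E * Phi y)%E) /\
  (Phi 0%R < +oo)%E /\
  (exists x0, 1 < x0 /\ (Phi x0 < +oo)%E) /\
  ereal_inf [set Phi x | x in [set x : R | 0 <= x]] = 0%E /\
  ((fun x : R => Phi x * (x^-1)%:E)%E @ +oo --> +oo%E).

(* Fenchel-Legendre conjugate Phi^*(y) = sup_{x >= 0} (x y - Phi(x));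
   it is real-valued under Phi_admissible, so we take its real part. *)
Definition phistar (Phi : R -> \bar R) (y : R) : R :=
  fine (ereal_sup [set ((x * y)%:E - Phi x)%E | x in [set x : R | 0 <= x]]).

Section Prob.
Context {dO : measure_display} {Omega : measurableType dO} (P : probability Omega R).

Definition HPhiStar (Phi : R -> \bar R) (X : Omega -> R) : Prop :=
  measurable_fun [set: Omega] X /\
  forall c : R, 0 < c -> (\int[P]_w (phistar Phi (c * `|X w|))%:E < +oo)%E.

Definition square_integrable (X : Omega -> R) : Prop :=
  measurable_fun [set: Omega] X /\
  P.-integrable [set: Omega] (fun w => (X w ^+ 2)%:E).

Definition Pouter (A : set Omega) : \bar R :=
  ereal_inf [set P B | B in [set B | measurable B /\ A `<=` B]].

Definition mutually_independent {d' : measure_display} {T' : measurableType d'}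
    (Z : nat -> Omega -> T') : Prop :=
  forall (J : seq nat) (B : nat -> set T'), uniq J ->
    (forall j, measurable (B j)) ->
    P (\bigcap_(j in [set j | j \in J]) (Z j @^-1` B j)) =
    (\prod_(j <- J) P (Z j @^-1` B j))%E.

Definition identically_distributed {d' : measure_display} {T' : measurableType d'}
    (Z : nat -> Omega -> T') : Prop :=
  forall j (A : set T'), measurable A -> P (Z j @^-1` A) = P (Z 0%N @^-1` A).

Definition Ex (X : Omega -> R) : R := fine (\int[P]_w (X w)%:E).

End Prob.

Section PL.
Context {m d r : nat} {s : 'I_r -> nat}
  (T : 'rV[R]_m -> 'rV[R]_d)
  (L : forall i : 'I_r, 'I_(s i) -> 'rV[R]_d -> R)
  (a : forall i : 'I_r, 'I_(s i) -> R)
  (I : forall i : 'I_r, 'I_(s i) -> set R)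
  (Lam : 'I_r -> 'rV[R]_d -> R) (b : 'I_r -> R).

Definition PLind (i : 'I_r) (theta : 'rV[R]_m) (z : 'rV[R]_d) : R :=
  \big[Order.min/1]_(l < s i) (indic (I i l) (L i l (T theta + z) + a i l) : R).

Definition PLform (theta : 'rV[R]_m) (z : 'rV[R]_d) : R :=
  \sum_(i < r) PLind i theta z * (Lam i (T theta + z) + b i).
End PL.

Definition lsc_on {m : nat} (Theta : set 'rV[R]_m) (f : 'rV[R]_m -> R) : Prop :=
  forall theta, Theta theta -> forall t : R, t < f theta ->
    \forall v \near theta, Theta v -> t < f v.

Section Assumptions.
Context {dO : measure_display} {Omega : measurableType dO} (P : probability Omega R)
  {m d : nat} (Z : nat -> {mfun Omega >-> Rvec R d})
  (Theta : set 'rV[R]_m) (Phi : R -> \bar R)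
  (G : 'rV[R]_m -> 'rV[R]_d -> R).

Definition PZ := distribution P (Z 0%N).

Definition hfun (g : 'rV[R]_m * R) (z : 'rV[R]_d) : R := phistar Phi (G g.1 z + g.2).

Definition empproc (n : nat) (f : 'rV[R]_d -> R) (w : Omega) : R :=
  n%:R^-1 * \sum_(j < n) (f (Z j w) - Ex P (fun v => f (Z j v))).

Definition dbarP2 (g1 g2 : 'rV[R]_m * R) : \bar R :=
  Lnorm PZ 2%:E (fun z : Rvec R d => (hfun g1 z - hfun g2 z)%:E).

Definition inThetaK (k : nat) (g : 'rV[R]_m * R) : Prop := Theta g.1 /\ `|g.2| <= k%:R.

Definition A1 : Prop :=
  measurable_fun (Theta `*` setT : set (Rvec R m * Rvec R d)%type)
    (fun p : Rvec R m * Rvec R d => G p.1 p.2) /\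
  (forall z, lsc_on Theta (fun theta => G theta z)).

Definition A2 : Prop :=
  exists xi1 : Rvec R d -> R,
    PZ.-integrable [set: Rvec R d] (fun z => (xi1 z)%:E) /\
    forall theta z, Theta theta -> `|G theta z| <= xi1 z.

Definition A3 : Prop :=
  (forall theta, Theta theta -> HPhiStar P Phi (fun w => G theta (Z 0%N w))) /\
  exists xi2 : Rvec R d -> R,
    PZ.-integrable [set: Rvec R d] (fun z => (xi2 z)%:E) /\
    forall theta z, Theta theta -> `|phistar Phi (G theta z)| <= xi2 z.

Definition A4 : Prop :=
  (forall theta x, Theta theta ->
     square_integrable P (fun w => phistar Phi (G theta (Z 0%N w) + x))) /\
  (forall k : nat,
     (ereal_sup [set \int[P]_w (phistar Phi (G g.1 (Z 0%N w) + g.2))%:E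
                 | g in inThetaK k] < +oo)%E).

Definition A5 (dbar : 'rV[R]_m * R -> 'rV[R]_m * R -> \bar R) : Prop :=
  (forall (k : nat) (e : R), 0 < e ->
     exists F : seq ('rV[R]_m * R),
       (forall g, g \in F -> inThetaK k g) /\
       forall g, inThetaK k g -> exists2 g', g' \in F & (dbar g g' < e%:E)%E) /\
  (forall (eps : R) (k : nat), 0 < eps ->
     (fun delta : R =>
        limn_esup (fun n : nat =>
          Pouter P [set w | exists g1 g2, inThetaK k g1 /\ inThetaK k g2 /\
                      (dbar g1 g2 < delta%:E)%E /\
                      eps < Num.sqrt n%:R *
                            `|empproc n (fun z => hfun g1 z - hfun g2 z) w|]))
     @ 0^'+ --> 0%E).

End Assumptions.
End Defs.

(* Main.v *)
(** The parts (A2)-(A4) follow from [|G theta z| <= |Lambda_i z| + C] for the active index [i], with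
    [C] a bound over the compact parameter set, and from convexity and monotonicity of the
    conjugate [phistar].  For (A5), each [h_(theta,x)] is a sum of products of functions taken from
    families [t |-> 1_I (L z + t)] and [t |-> phistar (Lambda z + t)] that are monotone in one real
    parameter and have a square integrable envelope.  If [f_t] increases with [t] and
    [0 <= f_t <= H], then [t |-> \int f_t W] takes values in a bounded interval; cutting this
    interval into [N] pieces gives [N] brackets with [\int D W = O(1/N)].  So the brackets have
    polynomial entropy, and Ossiander's chaining applies: with the Chernoff bound at each level
    [q], functions truncated at [W <= sqrt n 8^-q] and brackets with [\int D W <= 16^-q], the
    failure probabilities [O (B^q exp (- 4^q / 128))] are summable, and what the first truncation
    discards vanishes by Markov's inequality and dominated convergence. *)

(* Sizes are measured in the weighted norm $\int|f|W$, with the envelope W as weight, because one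
   bound in it does three jobs. For monotone families it is linear, so that a cell is an interval of
   values of one integral. As increments are at most 2W, it bounds second moments, hence the
   variances in the Chernoff bound. Off a truncation set W exceeds a multiple of $\sqrt n$, so it
   also bounds $\sqrt n$ times the mean of a bracket there. The rates fit together: with bracket
   size $16^{-q}$ and truncation at $\sqrt n\,8^{-q}$, the mean lost at a level is of order
   $8^q16^{-q}=2^{-q}$, which is summable and is also the deviation allowed at that level; the
   resulting exponent $4^q$ outweighs any cell count of geometric growth. A factor of G mixes
   indicators along different functionals and is in general not monotone in one real parameter.
   Differences are therefore split until each term moves along a single real number, and the
   brackets of the terms are added. Suprema over uncountable families need not be measurable, so
   probabilities are bounded through measurable covers. *)
Require Import Defs.
From HB Require Import structures.
From mathcomp Require Import all_boot all_order all_algebra.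
From mathcomp Require Import all_classical all_reals all_analysis.
From mathcomp Require Import measurable_realfun.
From mathcomp Require Import ring lra.

Import Order.TTheory GRing.Theory Num.Theory.
Import numFieldNormedType.Exports.
Local Open Scope classical_set_scope.
Local Open Scope ring_scope.

Set Implicit Arguments.
Unset Strict Implicit.
Unset Printing Implicit Defensive.

(** * The conjugate function *)

Section conjugate.
Context {R : realType} {Phi : R -> \bar R}.
Hypothesis HPhi : Phi_admissible Phi.

Let Phi_ge0 x : 0 <= x -> (0 <= Phi x)%E.
Proof. by case: HPhi => + _; exact. Qed.

(** Points where [Phi] is infinite contribute [-oo] to the supremum defining the conjugate. Hence
    this and the next lemma speak only of points with a real value [p]. *)
Lemma Phi_coercive (M : R) : exists2 x1, 0 < x1 &
  forall x p, x1 <= x -> Phi x = p%:E -> M * x <= p.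
Proof.
case: HPhi => _ [_ [_ [_ [_ [_ /cvgeyPge/(_ M)]]]]].
move=> [x1 [_ hx1]]; exists (Num.max x1 0 + 1).
  by rewrite ltr_pwDr// le_max lexx orbT.
move=> x p xle Phixp.
have x1x : x1 < x by rewrite (lt_le_trans _ xle)// ltr_pwDr// le_max lexx.
have x0 : 0 < x.
  by rewrite (lt_le_trans _ xle)// ltr_pwDr// le_max lexx orbT.
have := hx1 x x1x; rewrite /= Phixp -EFinM lee_fin.
by rewrite ler_pdivlMr.
Qed.

(** By coercivity with slope [y] the terms beyond [x1] are at most 0, and those below are at most
    $x_1|y|$ as $\Phi\ge0$. *)
Lemma phistar_has_ub (y : R) : exists c : R,
  forall x p, 0 <= x -> Phi x = p%:E -> x * y - p <= c.
Proof.
have [x1 x10 hx1] := Phi_coercive y.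
exists (x1 * `|y|) => x p x0 Phixp.
have p0 : 0 <= p by rewrite -lee_fin -Phixp Phi_ge0.
have [xx1|x1x] := leP x x1.
  have : x * y <= x1 * `|y|.
    by apply: (le_trans (ler_wpM2l x0 (ler_norm y))); exact: ler_wpM2r.
  by lra.
have := hx1 _ _ (ltW x1x) Phixp.
have : 0 <= x1 * `|y| by rewrite mulr_ge0// ltW.
by nra.
Qed.

Lemma phistar_set_le (y c : R) :
  (forall x p, 0 <= x -> Phi x = p%:E -> x * y - p <= c) ->
  (ereal_sup [set ((x * y)%:E - Phi x)%E | x in [set x : R | (0 <= x)%R]] <= c%:E)%E.
Proof.
move=> h; apply: ge_ereal_sup => _ [x /= x0 <-].
case E : (Phi x) (Phi_ge0 x0) => [p| |] // _; last by rewrite addeNy leNye.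
by rewrite -EFinB lee_fin; exact: h.
Qed.

Let Phi0_fin : exists2 p0, 0 <= p0 & Phi 0 = p0%:E.
Proof.
have := Phi_ge0 (lexx 0).
case: HPhi => _ [_ [_ [+ _]]].
by case: (Phi 0) => [p| |] //; exists p.
Qed.

Lemma phistar_fin y :
  ereal_sup [set ((x * y)%:E - Phi x)%E | x in [set x : R | (0 <= x)%R]]
  = (phistar Phi y)%:E.
Proof.
rewrite /phistar fineK// fin_numE; apply/andP; split.
  have [p0 _ Phi0] := Phi0_fin.
  rewrite -ltNye (@lt_le_trans _ _ (- p0)%:E) ?ltNyr//.
  by apply: ereal_sup_ubound; exists 0; rewrite //= Phi0 mul0r sub0e.
have [c /phistar_set_le hc] := phistar_has_ub y.
by rewrite -ltey (le_lt_trans hc)// ltry.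
Qed.

Lemma phistar_ub x y p : 0 <= x -> Phi x = p%:E -> x * y - p <= phistar Phi y.
Proof.
move=> x0 Phixp; rewrite -lee_fin -phistar_fin.
by apply: ereal_sup_ubound; exists x; rewrite //= Phixp EFinB.
Qed.

Lemma phistar_le y c :
  (forall x p, 0 <= x -> Phi x = p%:E -> x * y - p <= c) -> phistar Phi y <= c.
Proof. by move=> h; rewrite -lee_fin -phistar_fin; exact: phistar_set_le. Qed.

Lemma phistar_nondecreasing : nondecreasing_fun (phistar Phi).
Proof.
move=> y y' yy'; apply: phistar_le => x p x0 Phixp.
apply: le_trans (phistar_ub y' x0 Phixp).
by rewrite lerD2r ler_wpM2l.
Qed.

(** Since $\inf\Phi=0$, some [x] has [Phi x] below any given [e], and its term is at least [- e]. *)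
Lemma phistar_ge0 y : 0 <= y -> 0 <= phistar Phi y.
Proof.
move=> y0; apply/ler_addgt0Pl => e e0.
case: HPhi => _ [_ [_ [_ [_ [inf0 _]]]]].
have [] := @lb_ereal_inf_adherent R [set Phi x | x in [set x : R | 0 <= x]] e e0.
  by rewrite inf0.
move=> _ [x /= x0 <-]; rewrite inf0 add0e.
case E : (Phi x) (Phi_ge0 x0) => [p| |] // _; rewrite lte_fin => pe.
have := phistar_ub y x0 E; have := mulr_ge0 x0 y0.
by lra.
Qed.

Lemma phistar_lower : exists2 p0, 0 <= p0 & forall y, - p0 <= phistar Phi y.
Proof.
have [p0 p00 Phi0] := Phi0_fin; exists p0 => // y.
by have := phistar_ub y (lexx 0) Phi0; rewrite mul0r sub0r.
Qed.

(** The finite value at some $x_0>1$ gives an affine minorant of slope above 1. Through this bound,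
    integrability of the conjugate yields that of $\Lambda_i(Z_1)$ itself. *)
Lemma phistar_affine_lower : exists p0, forall y, 0 <= y ->
  y <= phistar Phi y + p0.
Proof.
case: HPhi => _ [_ [_ [_ [[x0 [x01 Phix0]] _]]]].
have x00 : 0 <= x0 by rewrite ltW// (lt_trans _ x01).
case E : (Phi x0) Phix0 (Phi_ge0 x00) => [p| |] // _ _.
exists p => y y0; have := phistar_ub y x00 E.
by nra.
Qed.

(** Convexity at [2 * u] and [2 * v]. It detaches a bounded shift from $c|\Lambda_i|$ at the price
    of doubling [c], which $H^{\Phi^*}$ permits. *)
Lemma phistar_midpoint u v :
  phistar Phi (u + v) <= (phistar Phi (2 * u) + phistar Phi (2 * v)) / 2.
Proof.
apply: phistar_le => x p x0 Phixp.
have := phistar_ub (2 * u) x0 Phixp; have := phistar_ub (2 * v) x0 Phixp.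
by lra.
Qed.

Lemma phistar_norm_le p0 y c : 0 <= p0 -> (forall u, - p0 <= phistar Phi u) ->
  `|y| <= c -> `|phistar Phi y| <= phistar Phi c + p0.
Proof.
move=> p00 hp0 yc; have c0 : 0 <= c by rewrite (le_trans _ yc).
have := phistar_nondecreasing (le_trans (ler_norm y) yc).
have := phistar_ge0 c0; have := hp0 y.
by rewrite ler_norml => *; apply/andP; split; lra.
Qed.

Lemma measurable_phistar : measurable_fun setT (phistar Phi).
Proof. exact: nondecreasing_measurable phistar_nondecreasing. Qed.

End conjugate.

(** * Independence and exponential inequalities *)

Section independent_product.
Context {R : realType} {dO : measure_display} {Omega : measurableType dO}
  (P : probability Omega R) {dT : measure_display} {T : measurableType dT}.
Import HBNNSimple.

(** [Y] is to be the product of all other factors of a product. The property assumed for indicators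
    passes to simple functions by linearity and to [F] by monotone convergence. *)
Lemma ge0_integral_indep (mu : {measure set T -> \bar R}) (Y : Omega -> R)
    (V : Omega -> T) (c : R) (F : T -> R) :
  measurable_fun setT Y -> (forall w, 0 <= Y w) -> measurable_fun setT V ->
  0 <= c ->
  (forall A, measurable A ->
    (\int[P]_w (Y w * \1_A (V w))%:E = c%:E * mu A)%E) ->
  measurable_fun setT F -> (forall x, 0 <= F x) ->
  (\int[P]_w (Y w * F (V w))%:E = c%:E * \int[mu]_x (F x)%:E)%E.
Proof.
move=> mY Y0 mV c0 hA mF F0.
have mFE : measurable_fun setT (EFin \o F) by exact/measurable_EFinP.
pose g := nnsfun_approx measurableT mFE.
have mg n : measurable_fun setT (EFin \o g n) by exact/measurable_EFinP.
have mYg (h : {nnsfun T >-> R}) : measurable_fun setT (fun w => (Y w * h (V w))%:E).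
  apply/measurable_EFinP; apply: measurable_funM => //.
  exact: (measurableT_comp _ mV).
have ndg n m x : (n <= m)%N -> g n x <= g m x.
  by move=> nm; exact/lefP/nd_nnsfun_approx.
have simple n : (\int[P]_w (Y w * g n (V w))%:E = c%:E * \int[mu]_x (g n x)%:E)%E.
  have mYi r : measurable_fun setT (fun w =>
      (Y w * (r * \1_(g n @^-1` [set r]) (V w)))%:E).
    apply/measurable_EFinP; apply: measurable_funM => //.
    apply: measurable_funM => //; apply: (measurableT_comp _ mV).
    exact: measurable_indic.
  have Yi0 r w : (0 <= (Y w * (r * \1_(g n @^-1` [set r]) (V w)))%:E)%E.
    rewrite lee_fin mulr_ge0//.
    by have := @nnfun_muleindic_ge0 _ _ _ (g n) r (V w); rewrite lee_fin.
  transitivity (\int[P]_w \sum_(r \in range (g n))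
      (Y w * (r * \1_(g n @^-1` [set r]) (V w)))%:E)%E.
    apply: eq_integral => w _; rewrite fimfunE fsumEFin//; congr EFin.
    by rewrite !fsbig_finite//= mulr_sumr.
  rewrite ge0_integral_fsum//.
  transitivity (\sum_(r \in range (g n)) (c%:E * (r%:E * mu (g n @^-1` [set r]))))%E.
    apply: eq_fsbigr => r; rewrite inE => -[x _ gxr].
    have r0 : 0 <= r by rewrite -gxr.
    transitivity (\int[P]_w (r%:E * (Y w * \1_(g n @^-1` [set r]) (V w))%:E))%E.
      by apply: eq_integral => w _; rewrite -EFinM mulrCA.
    rewrite ge0_integralZl//.
    - by rewrite hA// muleCA.
    - apply/measurable_EFinP; apply: measurable_funM => //.
      by apply: (measurableT_comp _ mV); exact: measurable_indic.
    - by move=> w _; rewrite lee_fin mulr_ge0.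
  rewrite integralT_nnsfun sintegralE.
  rewrite -ge0_mule_fsumr// => r.
  have [[x _ <-]|h] := pselect (range (g n) r).
    by rewrite mule_ge0// lee_fin.
  rewrite preimage10 ?measure0 ?mule0//.
have -> : (\int[mu]_x (F x)%:E = limn (fun n => \int[mu]_x (g n x)%:E))%E.
  rewrite -monotone_convergence//.
  - apply: eq_integral => x _.
    by apply/esym/cvg_lim => //; apply: (cvg_nnsfun_approx measurableT mFE) => // y _; rewrite lee_fin.
  - by move=> n x _; rewrite lee_fin.
  - by move=> x _ n m nm; rewrite lee_fin ndg.
have -> : (\int[P]_w (Y w * F (V w))%:E = limn (fun n => \int[P]_w (Y w * g n (V w))%:E))%E.
  rewrite -monotone_convergence//.
  - apply: eq_integral => w _.
    apply/esym/cvg_lim => //; rewrite EFinM.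
    under eq_fun do rewrite EFinM.
    apply: cvgeZl => //.
    by apply: (cvg_nnsfun_approx measurableT mFE) => // y _; rewrite lee_fin.
  - by move=> n w _; rewrite lee_fin mulr_ge0.
  - by move=> w _ n m nm; rewrite lee_fin ler_wpM2l// ndg.
under eq_fun do rewrite simple.
rewrite limeMl//; apply: ereal_nondecreasing_is_cvgn => n m nm.
apply: ge0_le_integral => //.
- by move=> x _; rewrite lee_fin.
- exact: mg.
- exact: mg.
- by move=> x _; rewrite lee_fin ndg.
Qed.

Context (Z : nat -> {mfun Omega >-> T}).
Hypothesis HZind : mutually_independent P (fun j => (Z j : Omega -> T)).
Hypothesis HZid : identically_distributed P (fun j => (Z j : Omega -> T)).
Let mu : probability T R := distribution P (Z 0%N).

Lemma indep_prod_integral (n k : nat) (F : nat -> T -> R) :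
  (forall j, measurable_fun setT (F j)) -> (forall j x, 0 <= F j x) ->
  (forall j, mu.-integrable setT (EFin \o F j)) ->
  (forall j, (k <= j)%N -> (j < n)%N ->
     exists2 B, measurable B & F j = \1_B) ->
  (\int[P]_w (\prod_(j < n) F j (Z j w))%:E
   = (\prod_(j < n) \int[mu]_x F j x)%:E)%E.
Proof.
(* Indicators are replaced by general functions one factor at a time. *)
elim: k F => [|k IH] F mF F0 iF hF.
  (* Independence asks for a set at every index; [setT] fills those from [n] on. *)
  have /choice[B hB] j : exists B, measurable B /\ ((j < n)%N -> F j = \1_B).
    have [jn|_] := ltnP j n; last by exists setT.
    by have [//|B mB FB] := hF j _ jn; exists B.
  transitivity (\int[P]_w (\1_(\bigcap_(j in [set j | j \in iota 0 n]) (Z j @^-1` B j)) w)%:E)%E.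
    apply: eq_integral => w _; congr EFin; rewrite indicE.
    have [/set_mem hw|/negP hw] := boolP (w \in _).
      rewrite big1// => j _; rewrite (hB j).2// indicE mem_set//.
      by apply: (hw j); rewrite /= mem_iota /= add0n.
    have [/forallP h|] := boolP [forall j : 'I_n, w \in Z j @^-1` B j].
      exfalso; apply: hw; apply/mem_set => j /=; rewrite mem_iota add0n /= => jn.
      by have := h (Ordinal jn); rewrite inE.
    rewrite negb_forall => /existsP[j /negP hj].
    rewrite (bigD1 j)//= (hB j).2// indicE.
    case: (boolP (_ \in _)) => [|_]; last by rewrite mul0r.
    by move=> /set_mem h; exfalso; apply: hj; apply/mem_set.
  rewrite integral_indic// ?setIT; last first.
    apply: bigcap_measurableType.
    move=> j _; rewrite -[X in measurable X]setTI.
    by apply: (measurable_funPT (Z j)) => //; exact: (hB j).1.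
  have := HZind (iota_uniq 0 n) (fun j => (hB j).1); rewrite /= => ->.
  have -> : iota 0 n = index_iota 0 n by rewrite /index_iota subn0.
  rewrite big_mkord -prodEFin.
  apply: eq_bigr => j _.
  rewrite HZid; last exact: (hB j).1.
  rewrite (hB j).2// /Rintegral integral_indic ?setIT//; last exact: (hB j).1.
  by rewrite fineK// fin_num_measure//; exact: (hB j).1.
have [kn|nk] := ltnP k n; last first.
  by apply: IH => // j kj jn; have := leq_trans jn (leq_trans nk kj); rewrite ltnn.
pose i := Ordinal kn.
have mZF j (f : T -> R) : measurable_fun setT f -> measurable_fun setT (fun w => f (Z j w)).
  by move=> mf; apply: (measurableT_comp mf).
pose Y w := \prod_(j < n | j != i) F j (Z j w).
pose c := \prod_(j < n | j != i) \int[mu]_x F j x.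
transitivity (\int[P]_w (Y w * F k (Z k w))%:E)%E.
  by apply: eq_integral => w _; rewrite (bigD1 i)//= mulrC.
rewrite (@ge0_integral_indep mu _ _ c)//.
- rewrite (bigD1 i)//= mulrC EFinM; congr (_ * _)%E.
  by rewrite /Rintegral fineK//; apply: integrable_fin_num => //; exact: (iF k).
- rewrite (_ : Y = fun w => \prod_(j <- [seq j <- index_enum _ | j != i]) F j (Z j w)).
    by apply: measurable_prod => j _; exact: mZF.
  by apply/funext => w; rewrite big_filter.
- by move=> w; apply: prodr_ge0.
- by apply: prodr_ge0 => j _; exact: Rintegral_ge0.
(* With the k-th factor replaced by an indicator only the factors below [k] are general, so the
   induction hypothesis applies. *)
- move=> A mA; pose F' j := if j == k then \1_A else F j.
  have F'i (j : 'I_n) : j != i -> F' j = F j.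
    by move=> ji; rewrite /F' ifN//; apply: contraNN ji => /eqP jk; apply/eqP/val_inj.
  have -> : (c%:E * mu A = (\prod_(j < n) \int[mu]_x F' j x)%:E)%E.
    rewrite (bigD1 i)//= {1}/F' eqxx mulrC EFinM; congr (_%:E * _)%E.
      by apply: eq_bigr => j ji; rewrite F'i.
    rewrite /Rintegral integral_indic// setIT fineK//; exact: fin_num_measure.
  rewrite -IH.
  + apply: eq_integral => w _; rewrite (bigD1 i)//= /F' eqxx mulrC.
    by congr (_ * _)%:E; apply: eq_bigr => j ji; rewrite -/(F' j) F'i.
  + by move=> j; rewrite /F'; case: ifP.
  + by move=> j x; rewrite /F'; case: ifP.
  + by move=> j; rewrite /F'; case: ifP => // _; exact: integrable_indic.
  + move=> j kj jn; rewrite /F'; case: ifPn => jk; first by exists A.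
    by apply: hF => //; rewrite ltn_neqAle eq_sym jk.
Qed.

End independent_product.

(** * Integrable real functions on a probability space *)

Section integrable_real.
Context {R : realType} {d : measure_display} {T : measurableType d}
  (mu : probability T R).

Implicit Types f g : T -> R.

Definition intg (f : T -> R) := mu.-integrable [set: T] (EFin \o f).

Lemma intg_measurable f : intg f -> measurable_fun setT f.
Proof. by move=> /integrableP[/measurable_EFinP]. Qed.

Lemma le_intg f g : measurable_fun setT f -> intg g ->
  (forall x, `|f x| <= g x) -> intg f.
Proof.
move=> mf ig fg; apply: le_integrable ig => //; first exact/measurable_EFinP.
by move=> x _; rewrite /= lee_fin (le_trans (fg x))// ler_norm.
Qed.

Lemma intg_cst c : intg (cst c).
Proof. exact: finite_measure_integrable_cst. Qed.

Lemma intgD f g : intg f -> intg g -> intg (fun x => f x + g x).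
Proof. by move=> iF ig; exact: (integrableD measurableT iF ig). Qed.

Lemma intgB f g : intg f -> intg g -> intg (fun x => f x - g x).
Proof. by move=> iF ig; exact: (integrableB measurableT iF ig). Qed.

Lemma intgZ c f : intg f -> intg (fun x => c * f x).
Proof. by move=> iF; exact: (integrableZl measurableT c iF). Qed.

Lemma intg_norm f : intg f -> intg (fun x => `|f x|).
Proof. by move=> iF; exact: (integrable_abse iF). Qed.

Lemma intg_sum (I : eqType) (s : seq I) (f : I -> T -> R) :
  (forall i, i \in s -> intg (f i)) -> intg (fun x => \sum_(i <- s) f i x).
Proof.
elim: s => [|i s IH] h.
  by under [X in intg X]eq_fun do rewrite big_nil; exact: intg_cst.
under [X in intg X]eq_fun do rewrite big_cons.
apply: intgD; first by apply: h; rewrite mem_head.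
by apply: IH => j js; apply: h; rewrite inE js orbT.
Qed.

Lemma Rintegral_cst1 c : \int[mu]_(x in setT) c = c.
Proof.
have mu1 : mu [set: T] = 1%E by exact: probability_setT.
by rewrite Rintegral_cst//= mu1 /= mulr1.
Qed.

Lemma Rintegral_le f g : intg f -> intg g -> (forall x, f x <= g x) ->
  \int[mu]_(x in setT) f x <= \int[mu]_(x in setT) g x.
Proof. by move=> iF ig fg; apply: le_Rintegral. Qed.

Lemma Rintegral_EFin f : intg f ->
  (\int[mu]_(x in setT) (f x)%:E = (\int[mu]_(x in setT) f x)%:E)%E.
Proof. by move=> iF; rewrite /Rintegral fineK//; apply: integrable_fin_num. Qed.

Lemma ge0_intg f : measurable_fun setT f -> (forall x, 0 <= f x) ->
  (\int[mu]_(x in setT) (f x)%:E < +oo)%E -> intg f.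
Proof.
move=> mf f0 fi; apply/integrableP; split; first exact/measurable_EFinP.
by under eq_integral do rewrite /= ger0_norm//.
Qed.

Lemma intg_sqr f : measurable_fun setT f -> intg (fun x => f x ^+ 2) -> intg f.
Proof.
move=> mf if2; apply: (@le_intg _ (fun x => 1 + f x ^+ 2)) => //.
  by apply: intgD => //; exact: intg_cst.
by move=> x; rewrite ler_norml; apply/andP; split; nra.
Qed.

End integrable_real.

(** * Outer probability bounds *)

Section outer.
Context {R : realType} {d : measure_display} {T : measurableType d}
  (P : probability T R).

(** A measurable cover as witness, rather than a bound on the infimum in [Pouter], makes union
    bounds immediate for events whose measurability is unclear. *)
Definition outer_le (A : set T) (c : R) :=
  exists2 B, measurable B & A `<=` B /\ (P B <= c%:E)%E.

Lemma outer_le_sub A B c e : A `<=` B -> c <= e -> outer_le B c -> outer_le A e.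
Proof.
move=> AB ce [C mC [BC PC]]; exists C => //; split; first exact: subset_trans BC.
by rewrite (le_trans PC)// lee_fin.
Qed.

Lemma outer_leU A B c e : outer_le A c -> outer_le B e -> outer_le (A `|` B) (c + e).
Proof.
move=> [A' mA' [AA' PA']] [B' mB' [BB' PB']]; exists (A' `|` B').
  exact: measurableU.
split; first exact: setUSS.
by rewrite (le_trans (measureU2 _ mA' mB'))// EFinD leeD.
Qed.

Lemma outer_le0 : outer_le set0 0.
Proof. by exists set0 => //; split=> //; rewrite measure0. Qed.

Lemma outer_le_bigU (I : Type) (s : seq I) (A : I -> set T) (c : I -> R) :
  (forall i, outer_le (A i) (c i)) ->
  outer_le (\big[setU/set0]_(i <- s) A i) (\sum_(i <- s) c i).
Proof.
move=> h; elim: s => [|i s IH]; rewrite ?big_nil ?big_cons; first exact: outer_le0.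
exact: outer_leU.
Qed.

Lemma outer_le_exists (I : finType) (A : I -> set T) (c : R) :
  (forall i, outer_le (A i) c) ->
  outer_le [set w | exists i, A i w] (#|I|%:R * c).
Proof.
move=> h; have := @outer_le_bigU I (enum I) A (fun=> c) h.
rewrite big_const_seq count_predT iter_addr_0 -cardT.
apply: outer_le_sub; last by rewrite mulr_natl.
move=> w [i Aiw]; rewrite -bigcup_seq; exists i => //=; by rewrite mem_enum.
Qed.

Lemma outer_le_Pouter A c : outer_le A c -> (Pouter P A <= c%:E)%E.
Proof.
move=> [B mB [AB PB]]; apply: le_trans PB.
by apply: ereal_inf_lbound; exists B.
Qed.

End outer.

(** * Empirical process and Chernoff bound *)

Section empirical.
Context {R : realType} {dO : measure_display} {Omega : measurableType dO}
  (P : probability Omega R) {dT : measure_display} {T : measurableType dT}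
  (Z : nat -> {mfun Omega >-> T}).
Hypothesis HZind : mutually_independent P (fun j => (Z j : Omega -> T)).
Hypothesis HZid : identically_distributed P (fun j => (Z j : Omega -> T)).

Let mu : probability T R := distribution P (Z 0%N).
Implicit Types f g F : T -> R.

Lemma intg_comp j f : intg mu f -> intg P (fun w => f (Z j w)).
Proof.
move=> /integrableP[mf fi]; apply/integrableP; split.
  by apply/measurable_EFinP; apply: measurableT_comp => //; exact/measurable_EFinP.
have mfZ : measurable_fun setT (fun x => `|(EFin \o f) x|%E)
  by apply: measurableT_comp.
suff -> : (\int[P]_w `|(EFin \o (fun w => f (Z j w))) w| = \int[mu]_x `|(EFin \o f) x|)%E by [].
transitivity (\int[distribution P (Z j)]_x `|(EFin \o f) x|)%E.
  by rewrite ge0_integral_distribution.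
by apply: eq_measure_integral => A mA _; exact: (HZid j mA).
Qed.

Lemma Rintegral_comp j f : intg mu f ->
  \int[P]_w f (Z j w) = \int[mu]_x f x.
Proof.
move=> iF; rewrite /Rintegral; congr fine.
have mf := measurable_int _ iF.
rewrite -(@integral_distribution _ _ _ _ _ P (Z j) (EFin \o f))//; last exact: intg_comp.
by apply: eq_measure_integral => A mA _; exact: (HZid j mA).
Qed.

(** This is $\sqrt n(\mathbb P_n-\mathbb P)f$, with the mean taken under the common law [mu]. *)
Definition Gn (n : nat) f (w : Omega) : R :=
  (Num.sqrt n%:R)^-1 * \sum_(j < n) (f (Z j w) - \int[mu]_x f x).

Lemma measurable_Gn n f : measurable_fun setT f -> measurable_fun setT (Gn n f).
Proof.
move=> mf; apply: measurable_funM => //; apply: measurable_sum => j.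
by apply: measurable_funB => //; exact: measurableT_comp.
Qed.

Lemma GnD n f g w : intg mu f -> intg mu g ->
  Gn n (fun x => f x + g x) w = Gn n f w + Gn n g w.
Proof.
move=> iF ig; rewrite /Gn RintegralD// -mulrDr -big_split/=; congr (_ * _).
by apply: eq_bigr => j _; ring.
Qed.

Lemma GnN n f w : intg mu f -> Gn n (fun x => - f x) w = - Gn n f w.
Proof.
move=> iF; rewrite /Gn -mulrN -sumrN; congr (_ * _); apply: eq_bigr => j _.
have -> : \int[mu]_x (- f x) = - \int[mu]_x f x.
  by under eq_Rintegral do rewrite -mulN1r; rewrite RintegralZl// mulN1r.
by ring.
Qed.

(** Termwise, $|f(Z_j)-\mathbb Ef|\le(F(Z_j)-\mathbb EF)+2\,\mathbb EF$. Passing to a bracket thus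
    costs twice $\sqrt n$ times its mean. *)
Lemma Gn_dominated n f F w : intg mu f -> intg mu F -> (forall x, `|f x| <= F x) ->
  `|Gn n f w| <= Gn n F w + 2 * Num.sqrt n%:R * \int[mu]_x F x.
Proof.
move=> iF iFF fF; case: n => [|n].
  by rewrite /Gn !big_ord0 !mulr0 normr0 sqrtr0 mulr0 mul0r addr0.
set s := Num.sqrt _.
have s0 : 0 < s by rewrite sqrtr_gt0 ltr0n.
have ss : s * s = n.+1%:R by rewrite -expr2 sqr_sqrtr.
have fF' : `|\int[mu]_x f x| <= \int[mu]_x F x.
  apply: (le_trans (le_normr_Rintegral measurableT iF)).
  by apply: Rintegral_le => //; exact: intg_norm.
rewrite /Gn -/s normrM (ger0_norm (x := s^-1)); last by rewrite invr_ge0 ltW.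
have -> : 2 * s * \int[mu]_x F x = s^-1 * (2 * n.+1%:R * \int[mu]_x F x).
  by rewrite -ss; field; rewrite gt_eqF.
rewrite -mulrDr ler_pM2l ?invr_gt0//.
apply: (le_trans (ler_norm_sum _ _ _)).
have -> : 2 * n.+1%:R * \int[mu]_x F x = \sum_(j < n.+1) (2 * \int[mu]_x F x).
  by rewrite sumr_const card_ord -[RHS]mulr_natl; ring.
rewrite -big_split/=; apply: ler_sum => j _.
apply: (le_trans (ler_normB _ _)).
by have := fF (Z j w); lra.
Qed.

(** Invert $1-y\le e^{-y}$ and use $(1-y)(1+y+2y^2)=1+y^2(1-2y)\ge1$. *)
Lemma expR_le_quadratic (y : R) : y <= 1 / 2 -> expR y <= 1 + y + 2 * y ^+ 2.
Proof.
move=> y2.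
have h : 1 - y <= expR (- y) by rewrite -[_ - _]/(1 + - y); exact: expR_ge1Dx.
have := expR_gt0 y; have e : expR (- y) * expR y = 1 by rewrite -expRD addNr expR0.
have h1 : 1 <= (1 - y) * (1 + y + 2 * y ^+ 2).
  have -> : (1 - y) * (1 + y + 2 * y ^+ 2) = 1 + y ^+ 2 * (1 - 2 * y) by ring.
  by rewrite lerDl mulr_ge0 ?sqr_ge0//; lra.
move=> e0; have := ler_wpM2r (ltW e0) h; rewrite e => h2.
have y1 : 0 < 1 - y by lra.
rewrite -(ler_pM2l y1); exact: le_trans h1.
Qed.

(** Independence splits the expectation into [n] equal factors. In each the exponent is at most 1/2
    by the condition on [lam], so the quadratic bound applies; centring removes the linear term, and
    the variance is at most the second moment. *)
Lemma Gn_mgf (n : nat) f (M s2 lam : R) : (0 < n)%N -> measurable_fun setT f ->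
  (forall x, `|f x| <= M) -> \int[mu]_x (f x ^+ 2) <= s2 -> 0 <= lam ->
  lam * (2 * M) <= Num.sqrt n%:R / 2 ->
  (\int[P]_w (expR (lam * Gn n f w))%:E <= (expR (2 * lam ^+ 2 * s2))%:E)%E.
Proof.
move=> n0 mf fM f2 lam0 lamM.
set s := Num.sqrt n%:R in lamM *.
have s0 : 0 < s by rewrite sqrtr_gt0 ltr0n.
have ss : s ^+ 2 = n%:R by rewrite sqr_sqrtr.
have M0 : 0 <= M by apply: le_trans (fM point).
have iF : intg mu f by apply: le_intg (intg_cst mu M) _.
have if2 : intg mu (fun x => f x ^+ 2).
  apply: (le_intg _ (intg_cst mu (M ^+ 2))) => //=.
    by apply: measurable_funX.
  by move=> x; rewrite normrX lerXn2r ?nnegrE.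
set m := \int[mu]_x f x.
have mM : `|m| <= M.
  apply: (le_trans (le_normr_Rintegral measurableT iF)).
  rewrite -[leRHS](Rintegral_cst1 mu); apply: Rintegral_le => //.
  - exact: intg_norm.
  - exact: intg_cst.
pose y x := lam / s * (f x - m).
have my : measurable_fun setT y.
  by apply: measurable_funM => //; apply: measurable_funB.
have y2 x : `|y x| <= 1 / 2.
  rewrite normrM (ger0_norm (x := lam / s)); last by rewrite divr_ge0// ltW.
  apply: (@le_trans _ _ (lam / s * (2 * M))).
    apply: ler_wpM2l; first by rewrite divr_ge0// ltW.
    by apply: (le_trans (ler_normB _ _)); have := fM x; lra.
  by rewrite mulrAC ler_pdivrMr//; lra.
have iy : intg mu (fun x => expR (y x)).
  apply: (le_intg _ (intg_cst mu (expR (1 / 2)))) => //=.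
    by apply: measurableT_comp.
  move=> x; rewrite ger0_norm ?expR_ge0// ler_expR.
  by apply: le_trans (y2 x); exact: ler_norm.
have Ey : \int[mu]_x expR (y x) <= expR (2 * lam ^+ 2 * s2 / n%:R).
  pose c := 2 * (lam / s) ^+ 2.
  have i1 : intg mu (fun x => f x - m) by apply: intgB => //; exact: intg_cst.
  have i2 : intg mu (fun x => (f x - m) ^+ 2).
    have -> : (fun x => (f x - m) ^+ 2) = fun x => (f x ^+ 2 + (- 2 * m) * f x) + m ^+ 2.
      by apply/funext => x; ring.
    apply: intgD; last exact: intg_cst.
    by apply: intgD => //; exact: intgZ.
  apply: (@le_trans _ _ (\int[mu]_x (1 + (lam / s) * (f x - m) + c * (f x - m) ^+ 2))).
    apply: Rintegral_le => //.
      apply: intgD; last exact: intgZ.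
      by apply: intgD; [exact: intg_cst|exact: intgZ].
    move=> x; have := expR_le_quadratic (le_trans (ler_norm _) (y2 x)).
    by rewrite /c /y exprMn mulrA.
  rewrite RintegralD//; last 2 first.
  - by apply: intgD; [exact: intg_cst|exact: intgZ].
  - exact: intgZ.
  rewrite RintegralD//; last 2 first.
  - exact: intg_cst.
  - exact: intgZ.
  rewrite Rintegral_cst1 !RintegralZl// RintegralB//; last exact: intg_cst.
  rewrite Rintegral_cst1 subrr mulr0 addr0.
  have var : \int[mu]_x ((f x - m) ^+ 2) <= s2.
    apply: le_trans f2.
    have -> : (fun x => (f x - m) ^+ 2) = fun x => (f x ^+ 2 + (- 2 * m) * f x) + m ^+ 2.
      by apply/funext => x; ring.
    rewrite RintegralD//; last 2 first.
    - by apply: intgD => //; exact: intgZ.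
    - exact: intg_cst.
    rewrite RintegralD//; last exact: intgZ.
    rewrite Rintegral_cst1 RintegralZl// -/m.
    by have := sqr_ge0 m; rewrite expr2; nra.
  apply: (@le_trans _ _ (1 + 2 * lam ^+ 2 * s2 / n%:R)); last exact: expR_ge1Dx.
  rewrite lerD2l -ss /c exprMn exprVn.
  have -> : 2 * lam ^+ 2 * s2 / s ^+ 2 = 2 * (lam ^+ 2 * s ^- 2) * s2 by ring.
  by apply: ler_wpM2l => //; rewrite mulr_ge0// mulr_ge0 ?sqr_ge0// invr_ge0 sqr_ge0.
under eq_integral => w _.
  have -> : expR (lam * Gn n f w) = \prod_(j < n) expR (y (Z j w)).
    rewrite -expR_sum /Gn mulrA mulr_sumr; congr expR.
  over.
(* With [k = n] no factor has to be an indicator. *)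
rewrite /= (@indep_prod_integral _ _ _ P _ _ Z HZind HZid n n (fun=> fun x => expR (y x)))//.
- rewrite lee_fin prodr_const card_ord.
  apply: (@le_trans _ _ (expR (2 * lam ^+ 2 * s2 / n%:R) ^+ n)).
    by rewrite lerXn2r ?nnegrE ?expR_ge0//; apply: Rintegral_ge0 => x _; exact: expR_ge0.
  rewrite -expRM_natl ler_expR mulrCA mulfV ?mulr1//.
  by rewrite pnatr_eq0 -lt0n.
- by move=> j; apply: measurableT_comp.
- by move=> j; rewrite leqNgt => /negbTE ->.
Qed.

(** Markov's inequality for the exponential; [lam] stays free so that every chaining level can
    choose its own. *)
Lemma Gn_tail (n : nat) f (M s2 lam x : R) : (0 < n)%N -> measurable_fun setT f ->
  (forall z, `|f z| <= M) -> \int[mu]_z (f z ^+ 2) <= s2 -> 0 <= lam ->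
  lam * (2 * M) <= Num.sqrt n%:R / 2 ->
  outer_le P [set w | x < Gn n f w] (expR (2 * lam ^+ 2 * s2 - lam * x)).
Proof.
move=> n0 mf fM f2 lam0 lamM.
have mG := measurable_Gn n mf.
have mB : measurable [set w | x < Gn n f w].
  have := mG measurableT `]x, +oo[%classic (measurable_itv _).
  by congr (measurable _); apply/seteqP; split=> w /=; rewrite ?in_itv/= ?andbT => -[].
exists [set w | x < Gn n f w] => //; split=> //.
rewrite expRD expRN EFinM lee_pdivlMr ?expR_gt0//.
apply: le_trans (Gn_mgf n0 mf fM f2 lam0 lamM).
have -> : (P [set w | (x < Gn n f w)%R] = \int[P]_w (\1_[set w | (x < Gn n f w)%R] w)%:E)%E.
  by rewrite integral_indic// setIT.
rewrite muleC -ge0_integralZl//; last first.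
  by apply/measurable_EFinP.
apply: ge0_le_integral => //.
- by apply/measurable_EFinP; apply: measurable_funM => //; exact: measurable_indic.
- by apply/measurable_EFinP; apply: measurableT_comp => //; apply: measurable_funM.
- move=> w _; rewrite -EFinM lee_fin indicE.
  have [/set_mem /= xG|_] := boolP (w \in _).
    by rewrite mulr1 ler_expR ler_wpM2l// ltW.
  by rewrite mulr0 expR_ge0.
Qed.

Lemma Gn_tail_norm (n : nat) f (M s2 lam x : R) : (0 < n)%N -> measurable_fun setT f ->
  (forall z, `|f z| <= M) -> \int[mu]_z (f z ^+ 2) <= s2 -> 0 <= lam ->
  lam * (2 * M) <= Num.sqrt n%:R / 2 ->
  outer_le P [set w | x < `|Gn n f w| ] (2 * expR (2 * lam ^+ 2 * s2 - lam * x)).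
Proof.
move=> n0 mf fM f2 lam0 lamM.
have iF : intg mu f by apply: le_intg (intg_cst mu M) _.
rewrite mulr2n mulrDl mul1r.
apply: outer_le_sub (lexx _) (outer_leU (Gn_tail x n0 mf fM f2 lam0 lamM)
  (@Gn_tail n (fun z => - f z) M s2 lam x n0 _ _ _ lam0 lamM)).
- move=> w /=; rewrite GnN// lter_normr => /orP[]; by [left|right].
- exact: measurableT_comp.
- by move=> z; rewrite normrN.
- by under eq_Rintegral do rewrite sqrrN.
Qed.

End empirical.

(** * Bracketing *)

Section bracketing.
Context {R : realType} {d : measure_display} {T : measurableType d}
  (mu : probability T R) {Gam : Type} (inG : Gam -> Prop) (W : T -> R).

(* Bracketing numbers in the norm [f |-> \int |f| W] grow polynomially; [e g g'] plays the role
   of [|h_g - h_g'|]. Since the brackets are at most [2 W], this also controls their [L2] norm. *)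
Definition bracketed (e : Gam -> Gam -> T -> R) : Prop :=
  exists (C K : nat) (c : R), 0 <= c /\
  forall N, (0 < N)%N -> exists (I : finType) (k : Gam -> I) (D : I -> T -> R),
    [/\ (#|I| <= C * N ^ K)%N,
        forall i, [/\ measurable_fun setT (D i), forall x, 0 <= D i x,
          intg mu (fun x => D i x * W x) & \int[mu]_x (D i x * W x) <= c / N%:R] &
        forall g g', inG g -> inG g' -> k g = k g' -> forall x, e g g' x <= D (k g) x].

Lemma bracketed_le e e' : (forall g g' x, inG g -> inG g' -> e g g' x <= e' g g' x) ->
  bracketed e' -> bracketed e.
Proof.
move=> ee' [C [K [c [c0 h]]]]; exists C, K, c; split=> // N N0.
have [I [k [D [h1 h2 h3]]]] := h N N0; exists I, k, D; split=> // g g' gg g'g kg x.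
by apply: le_trans (h3 _ _ gg g'g kg x); exact: ee'.
Qed.

Lemma bracketed0 : bracketed (fun _ _ _ => 0).
Proof.
exists 1%N, 0%N, 0; split=> // N N0; exists unit, (fun=> tt), (fun _ _ => 0).
split=> //; first by rewrite card_unit expn0.
move=> _; split=> //.
  by under [X in intg _ X]eq_fun do rewrite mul0r; exact: intg_cst.
by under eq_Rintegral do rewrite mul0r; rewrite Rintegral_cst1 mul0r.
Qed.

(** Pairs of labels: cell counts multiply and stay polynomial, while weighted sizes add. *)
Lemma bracketedD e1 e2 : bracketed e1 -> bracketed e2 ->
  bracketed (fun g g' x => e1 g g' x + e2 g g' x).
Proof.
move=> [C1 [K1 [c1 [c10 h1]]]] [C2 [K2 [c2 [c20 h2]]]].
exists (C1 * C2)%N, (K1 + K2)%N, (c1 + c2); split; first exact: addr_ge0.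
move=> N N0.
have [I1 [k1 [D1 [cI1 hD1 hk1]]]] := h1 N N0.
have [I2 [k2 [D2 [cI2 hD2 hk2]]]] := h2 N N0.
exists (I1 * I2)%type, (fun g => (k1 g, k2 g)), (fun i x => D1 i.1 x + D2 i.2 x).
split.
- by rewrite card_prod expnD mulnACA leq_mul.
- move=> [i1 i2] /=.
  have [m1 p1 ii1 b1] := hD1 i1; have [m2 p2 ii2 b2] := hD2 i2.
  have E : (fun x => (D1 i1 x + D2 i2 x) * W x) = fun x => D1 i1 x * W x + D2 i2 x * W x.
    by apply/funext => x; rewrite mulrDl.
  rewrite E; split.
  + exact: measurable_funD.
  + by move=> x; rewrite addr_ge0.
  + exact: intgD.
  + by rewrite RintegralD// mulrDl lerD.
- move=> g g' gg g'g [e1e e2e] x /=.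
  by rewrite lerD ?hk1 ?hk2.
Qed.

Lemma bracketed_sum (J : Type) (s : seq J) (e : J -> Gam -> Gam -> T -> R) :
  (forall j, bracketed (e j)) ->
  bracketed (fun g g' x => \sum_(j <- s) e j g g' x).
Proof.
move=> h; elim: s => [|j s IH].
  by apply: bracketed_le bracketed0 => g g' x _ _; rewrite big_nil.
apply: bracketed_le (bracketedD (h j) IH) => g g' x _ _; by rewrite big_cons.
Qed.

(** $f^2\le F\cdot2W$, which turns weighted first moments of brackets into variance bounds. *)
Lemma integral_sqr_le (f F : T -> R) (s : R) : measurable_fun setT f ->
  (forall x, `|f x| <= 2 * W x) -> (forall x, `|f x| <= F x) ->
  intg mu (fun x => F x * W x) -> \int[mu]_x (F x * W x) <= s ->
  intg mu (fun x => f x ^+ 2) /\ \int[mu]_x (f x ^+ 2) <= 2 * s.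
Proof.
move=> mf fW fF iF Fs.
have f2 x : f x ^+ 2 <= 2 * (F x * W x).
  have := ler_pM (normr_ge0 _) (normr_ge0 _) (fF x) (fW x).
  by rewrite -expr2 -normrX ger0_norm ?sqr_ge0// mulrCA.
have i2 : intg mu (fun x => f x ^+ 2).
  apply: (le_intg _ (intgZ 2 iF)) => [|x]; first exact: measurable_funX.
  by rewrite ger0_norm ?sqr_ge0.
split=> //; apply: (@le_trans _ _ (\int[mu]_x (2 * (F x * W x)))).
  by apply: Rintegral_le => //; exact: intgZ.
by rewrite RintegralZl// ler_wpM2l.
Qed.

(* [h_g] is within the bracket [net_bracket i], [i] the label of [g], of [h] at the representative
   [net_repr i]; at unlabelled cells the representative is arbitrary. *)
Record net := Net { net_cells : finType; net_label : Gam -> net_cells;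
  net_repr : net_cells -> Gam; net_bracket : net_cells -> T -> R }.
Arguments net_repr : clear implicits.
Arguments net_bracket : clear implicits.

Definition is_net (h : Gam -> T -> R) (s : R) (M : nat) (t : net) : Prop :=
  [/\ (#|net_cells t| <= M)%N,
      forall i, [/\ measurable_fun setT (net_bracket t i), forall x, 0 <= net_bracket t i x <= 2 * W x,
        intg mu (fun x => net_bracket t i x * W x) & \int[mu]_x (net_bracket t i x * W x) <= s],
      forall g, inG g -> inG (net_repr t (net_label t g)) &
      forall g, inG g -> forall x,
        `|h g x - h (net_repr t (net_label t g)) x| <= net_bracket t (net_label t g) x].

(** Taking $N=c'16^q$ makes the weighted size at most $16^{-q}$ and the cell count
    $C\,c'^K(16^K)^q$, geometric in [q]. Cutting the brackets at [2 * W] keeps them valid because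
    [h] is bounded by [W]. Here [g0] represents cells that contain no index. *)
Lemma bracketed_net (g0 : Gam) (h : Gam -> T -> R) :
  measurable_fun setT W -> (forall x, 0 <= W x) -> (forall g x, inG g -> `|h g x| <= W x) ->
  bracketed (fun g g' x => `|h g x - h g' x|) ->
  exists (C B : nat) (t : nat -> net), forall q, is_net h (16 ^- q) (C * B ^ q) (t q).
Proof.
move=> mW W0 hW [C [K [c [c0 hb]]]].
pose c' := (Num.truncn c).+1.
have cc' : c <= c'%:R by rewrite ltW// truncnS_gt.
exists (C * c' ^ K)%N, (16 ^ K)%N.
suff /choice[t ht] q : exists t, is_net h (16 ^- q) (C * c' ^ K * (16 ^ K) ^ q) t by exists t.
have [|I [k [D [cI hD hk]]]] := hb (c' * 16 ^ q)%N; first by rewrite muln_gt0 expn_gt0.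
have /choice[r hr] i : exists g, (exists2 g', inG g' & k g' = i) -> inG g /\ k g = i.
  have [[g' gg' kg']|no] := pselect (exists2 g', inG g' & k g' = i); first by exists g'.
  by exists g0.
exists (Net k r (fun i x => Num.min (D i x) (2 * W x))); split => /=.
- by rewrite (leq_trans cI)// expnMn -mulnA -!expnM (mulnC K).
- move=> i; have [mD D0 iD bD] := hD i.
  have mm : measurable_fun setT (fun x => Num.min (D i x) (2 * W x)).
    by apply: measurable_minr => //; exact: measurable_funM.
  have im : intg mu (fun x => Num.min (D i x) (2 * W x) * W x).
    apply: (le_intg _ iD) => [|x]; first exact: measurable_funM.
    rewrite ger0_norm; last by rewrite mulr_ge0// le_min D0 mulr_ge0.
    by rewrite ler_wpM2r// ge_min lexx.
  split=> //.
    by move=> x; rewrite le_min D0 mulr_ge0//= ge_min lexx orbT.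
  apply: (@le_trans _ _ (c / (c' * 16 ^ q)%:R)).
    apply: le_trans bD; apply: Rintegral_le => // x.
    by rewrite ler_wpM2r// ge_min lexx.
  rewrite natrM invfM natrX mulrA ler_piMl ?invr_ge0 ?exprn_ge0//.
  by rewrite ler_pdivrMr ?mul1r ?ltr0n.
- by move=> g gg; apply: (hr (k g) _).1; exists g.
- move=> g gg x; have [rg kr] := hr (k g) (ex_intro2 _ _ g gg erefl).
  rewrite le_min; apply/andP; split; first exact: hk.
  apply: (le_trans (ler_normB _ _)).
  by have := hW g x gg; have := hW _ x rg; lra.
Qed.

End bracketing.
Arguments net_repr {R d T Gam} n.
Arguments net_bracket {R d T Gam} n.

(** * Chaining *)

Section chaining.
Context {R : realType} {dO : measure_display} {Omega : measurableType dO}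
  (P : probability Omega R) {dT : measure_display} {T : measurableType dT}
  (Z : nat -> {mfun Omega >-> T}).
Hypothesis HZind : mutually_independent P (fun j => (Z j : Omega -> T)).
Hypothesis HZid : identically_distributed P (fun j => (Z j : Omega -> T)).
Let mu : probability T R := distribution P (Z 0%N).

Context {Gam : Type} (inG : Gam -> Prop) (h : Gam -> T -> R) (W : T -> R).
Hypothesis mW : measurable_fun setT W.
Hypothesis W1 : forall x, 1 <= W x.
Hypothesis iW2 : intg mu (fun x => W x ^+ 2).
Hypothesis mh : forall g, inG g -> measurable_fun setT (h g).
Hypothesis hW : forall g x, inG g -> `|h g x| <= W x.

Context (M : nat -> nat) (t : nat -> @net R dT T Gam).
Hypothesis ht : forall q, is_net mu inG W h (16 ^- q) (M q) (t q).

Let r q g := net_repr (t q) (net_label (t q) g).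
Let D q g := net_bracket (t q) (net_label (t q) g).

Let W0 x : 0 <= W x. Proof. by rewrite (le_trans _ (W1 x)). Qed.

Let iW : intg mu W. Proof. by apply: intg_sqr. Qed.

Let rG q g : inG g -> inG (r q g). Proof. by case: (ht q) => _ _ + _; exact. Qed.

Let hD q g x : inG g -> `|h g x - h (r q g) x| <= D q g x.
Proof. by case: (ht q) => _ _ _ + gg; exact. Qed.

Implicit Types (n q : nat) (A : set T) (f : T -> R).

(* Truncating at [W <= sqrt n * 8^-q], the same set for all indices, makes nestedness of the
   partitions unnecessary. *)
Definition level (n q : nat) : set T := [set x | W x <= Num.sqrt n%:R * 8 ^- q].

Lemma level_bound_ge0 n q : 0 <= 2 * (Num.sqrt n%:R * 8 ^- q) :> R.
Proof. by rewrite mulr_ge0// mulr_ge0 ?sqrtr_ge0// invr_ge0 exprn_ge0. Qed.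

Lemma measurable_level n q : measurable (level n q).
Proof.
have := mW measurableT (measurable_itv `]-oo, (Num.sqrt n%:R * 8 ^- q : R)]).
by congr (measurable _); apply/seteqP; split=> w /=; rewrite ?in_itv//= => -[].
Qed.

Lemma level_subset n q : level n q.+1 `<=` level n q.
Proof.
move=> x /= h1; apply: (le_trans h1); rewrite ler_wpM2l ?sqrtr_ge0//.
by rewrite lef_pV2 ?posrE ?exprn_gt0// ler_eXn2l// ltr1n.
Qed.

Definition cut (A : set T) (f : T -> R) x := f x * \1_A x.

Lemma measurable_cut A f : measurable A -> measurable_fun setT f ->
  measurable_fun setT (cut A f).
Proof. by move=> mA mf; apply: measurable_funM => //; exact: measurable_indic. Qed.

Lemma norm_cut A f x : `|cut A f x| <= `|f x|.
Proof.
by rewrite /cut indicE; case: (_ \in _); rewrite ?mulr1// mulr0 normr0.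
Qed.

Lemma norm_cut_le A f x (c : R) : 0 <= c -> (A x -> `|f x| <= c) -> `|cut A f x| <= c.
Proof.
move=> c0 h1; rewrite /cut indicE.
have [/set_mem/h1|_] := boolP (x \in A); first by rewrite mulr1.
by rewrite mulr0 normr0.
Qed.

Lemma intg_cut A f : measurable A -> intg mu f -> intg mu (cut A f).
Proof.
move=> mA iF; apply: (le_intg _ (intg_norm iF)) => [|x]; last exact: norm_cut.
by apply: measurable_cut => //; exact: intg_measurable iF.
Qed.

(* Chernoff's bound at [lam = 8^q / 64] for functions bounded by [2 sqrt n 8^-q] whose square has
   integral at most [16 * 16^-q]. *)
Definition level_prob q : R := 2 * expR (- (4 ^+ q / 128)).

Lemma level_tail n q f : (0 < n)%N -> measurable_fun setT f ->
  (forall x, `|f x| <= 2 * (Num.sqrt n%:R * 8 ^- q)) ->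
  \int[mu]_x (f x ^+ 2) <= 16 * 16 ^- q ->
  outer_le P [set w | 2 ^- q < `|Gn P Z n f w| ] (level_prob q).
Proof.
move=> n0 mf fb f2.
have := @Gn_tail_norm _ _ _ P _ _ Z HZind HZid n f _ _ (8 ^+ q / 64) (2 ^- q) n0 mf fb f2.
(* The variance term is $4^q/128$ and the linear term $4^q/64$. *)
have -> : 2 * (8 ^+ q / 64) ^+ 2 * (16 * 16 ^- q) - 8 ^+ q / 64 * 2 ^- q = - (4 ^+ q / 128) :> R.
  have -> : 8 ^+ q = 2 ^+ q * 4 ^+ q :> R by rewrite -exprMn; congr (_ ^+ _); ring.
  have -> : 16 ^+ q = 4 ^+ q * 4 ^+ q :> R by rewrite -exprMn; congr (_ ^+ _); ring.
  have -> : 4 ^+ q = 2 ^+ q * 2 ^+ q :> R by rewrite -exprMn; congr (_ ^+ _); ring.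
  have : (2 : R) ^+ q != 0 by rewrite expf_neq0.
  by move=> e0; field.
apply; first by rewrite divr_ge0// exprn_ge0.
have e0 : (8 : R) ^+ q != 0 by rewrite expf_neq0.
have -> : 8 ^+ q / 64 * (2 * (2 * (Num.sqrt n%:R * 8 ^- q))) = Num.sqrt n%:R / 16 :> R.
  by field.
by have := @sqrtr_ge0 R n%:R; lra.
Qed.

Lemma level_prob_ge0 q : 0 <= level_prob q.
Proof. by rewrite mulr_ge0// expR_ge0. Qed.

(** The bracket depends on [g] only through its cell, so a union over at most [M q] cells suffices.
    The set [A] will be the shell between consecutive levels, or the last level. *)
Lemma bracket_event n q A : (0 < n)%N -> measurable A -> A `<=` level n q ->
  outer_le P [set w | exists g, inG g /\ 2 ^- q < `|Gn P Z n (cut A (D q g)) w| ]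
    ((M q)%:R * level_prob q).
Proof.
move=> n0 mA AA; case: (ht q) => cI hDi _ _.
apply: (@outer_le_sub _ _ _ P _ [set w | exists i : net_cells (t q),
    2 ^- q < `|Gn P Z n (cut A (net_bracket (t q) i)) w| ]
    ((#|net_cells (t q)|)%:R * level_prob q)).
- by move=> w [g [_ ?]]; exists (net_label (t q) g).
- by rewrite ler_wpM2r ?level_prob_ge0// ler_nat.
apply: (@outer_le_exists _ _ _ P) => i; have [mDi Di iDi bDi] := hDi i.
have mc : measurable_fun setT (cut A (net_bracket (t q) i)) by apply: measurable_cut.
have cD x : `|cut A (net_bracket (t q) i) x| <= net_bracket (t q) i x.
  by apply: (le_trans (norm_cut _ _ _)); rewrite ger0_norm//; case/andP: (Di x).
have [|i2 b2] := integral_sqr_le mc _ cD iDi bDi.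
  by move=> x; apply: (le_trans (cD x)); case/andP: (Di x).
apply: level_tail => //.
  move=> x; apply: norm_cut_le => [|Ax]; first exact: level_bound_ge0.
  have /andP[D0 DW] := Di x; rewrite ger0_norm// (le_trans DW)//.
  by rewrite ler_pM2l//; exact: AA.
apply: (le_trans b2); rewrite ler_wpM2r// ?invr_ge0 ?exprn_ge0//.
by rewrite ler_nat.
Qed.

(** The increment depends only on two cells and is at most the sum of their brackets; the weighted
    size of this sum is at most $2\cdot16^{-q}$, the second moment of the increment at most twice
    that. *)
Lemma link_event n q : (0 < n)%N ->
  outer_le P [set w | exists g, inG g /\
      2 ^- q < `|Gn P Z n (cut (level n q.+1) (fun x => h (r q.+1 g) x - h (r q g) x)) w| ]
    ((M q)%:R * (M q.+1)%:R * level_prob q).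
Proof.
move=> n0; case: (ht q) => cI hDi _ _; case: (ht q.+1) => cI' hDi' _ _.
apply: (@outer_le_sub _ _ _ P _ [set w | exists i : (net_cells (t q) * net_cells (t q.+1))%type,
   [set w | exists g, [/\ inG g, net_label (t q) g = i.1, net_label (t q.+1) g = i.2 &
    2 ^- q < `|Gn P Z n (cut (level n q.+1)
      (fun x => h (net_repr (t q.+1) i.2) x - h (net_repr (t q) i.1) x)) w| ]] w]
    ((#|{: net_cells (t q) * net_cells (t q.+1)}|)%:R * level_prob q)).
- by move=> w [g [gg ?]]; exists (net_label (t q) g, net_label (t q.+1) g); exists g.
- by rewrite ler_wpM2r ?level_prob_ge0// -natrM ler_nat card_prod leq_mul.
apply: (@outer_le_exists _ _ _ P) => -[i i'] /=.
(* A pair of cells with no common index gives an empty event. *)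
have [[g gg [ki ki']]|no] := pselect (exists2 g, inG g &
    net_label (t q) g = i /\ net_label (t q.+1) g = i'); last first.
  apply: (outer_le_sub _ (level_prob_ge0 q) (outer_le0 P)).
  by move=> w [g [gg ki ki' _]]; apply: no; exists g.
apply: (@outer_le_sub _ _ _ P _ [set w | 2 ^- q <
    `|Gn P Z n (cut (level n q.+1) (fun x => h (r q.+1 g) x - h (r q g) x)) w| ] (level_prob q)) => //.
  by move=> w [? [_ _ _]]; rewrite /= /r ki ki'.
set f := fun x => _ - _.
have mf : measurable_fun setT f by apply: measurable_funB; apply: mh; exact: rG.
have [mDi Di iDi bDi] := hDi (net_label (t q) g).
have [mDi' Di' iDi' bDi'] := hDi' (net_label (t q.+1) g).
have mc : measurable_fun setT (cut (level n q.+1) f).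
  by apply: measurable_cut => //; exact: measurable_level.
have fW x : `|f x| <= 2 * W x.
  apply: (le_trans (ler_normB _ _)).
  by have := hW x (rG q gg); have := hW x (rG q.+1 gg); lra.
have fD x : `|f x| <= D q g x + D q.+1 g x.
  have -> : f x = (h g x - h (r q g) x) - (h g x - h (r q.+1 g) x) by rewrite /f; ring.
  by apply: (le_trans (ler_normB _ _)); rewrite lerD// hD.
have E : (fun x => (D q g x + D q.+1 g x) * W x) = fun x => D q g x * W x + D q.+1 g x * W x.
  by apply/funext => x; rewrite mulrDl.
have s16 : 16 ^- q.+1 <= 16 ^- q :> R.
  by rewrite lef_pV2 ?posrE ?exprn_gt0// ler_eXn2l// ltr1n.
have [||||i2 b2] := @integral_sqr_le _ _ _ mu W _ (fun x => D q g x + D q.+1 g x) (2 * 16 ^- q) mc.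
- by move=> x; exact: le_trans (norm_cut _ _ _) (fW x).
- by move=> x; exact: le_trans (norm_cut _ _ _) (fD x).
- by rewrite E; exact: intgD.
- rewrite E RintegralD//; apply: (le_trans (lerD bDi bDi')).
  by move: s16; lra.
apply: level_tail => //.
  move=> x; apply: norm_cut_le => [|/level_subset Ax]; first exact: level_bound_ge0.
  by rewrite (le_trans (fW x))// ler_pM2l.
apply: (le_trans b2); have : 0 <= 16 ^- q :> R by rewrite invr_ge0 exprn_ge0.
by lra.
Qed.

(** This is the only event in which closeness of [g1] and [g2] enters. The difference of
    representatives consists of three differences whose squares have integrals at most
    $2\cdot16^{-q}$, $2\cdot16^{-q}$ and $16^{-q}$; with the factor 3 for the square of a sum this
    gives $15\cdot16^{-q}$, within what [level_tail] admits. *)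
Lemma pair_event n q : (0 < n)%N ->
  outer_le P [set w | exists g1 g2, [/\ inG g1, inG g2,
      \int[mu]_x ((h g1 x - h g2 x) ^+ 2) <= 16 ^- q &
      2 ^- q < `|Gn P Z n (cut (level n q) (fun x => h (r q g1) x - h (r q g2) x)) w| ]]
    ((M q)%:R * (M q)%:R * level_prob q).
Proof.
move=> n0; case: (ht q) => cI hDi _ _.
apply: (@outer_le_sub _ _ _ P _ [set w | exists i : (net_cells (t q) * net_cells (t q))%type,
   [set w | exists g1 g2, [/\ inG g1, inG g2,
      \int[mu]_x ((h g1 x - h g2 x) ^+ 2) <= 16 ^- q &
    [/\ net_label (t q) g1 = i.1, net_label (t q) g2 = i.2 &
    2 ^- q < `|Gn P Z n (cut (level n q)
      (fun x => h (net_repr (t q) i.1) x - h (net_repr (t q) i.2) x)) w| ]]] w]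
    ((#|{: net_cells (t q) * net_cells (t q)}|)%:R * level_prob q)).
- by move=> w [g1 [g2 [gg1 gg2 g12 ?]]]; exists (net_label (t q) g1, net_label (t q) g2); exists g1, g2.
- by rewrite ler_wpM2r ?level_prob_ge0// -natrM ler_nat card_prod leq_mul.
apply: (@outer_le_exists _ _ _ P) => -[i i'] /=.
have [[g1 [g2 [gg1 gg2 g12 ki ki']]]|no] := pselect (exists g1 g2, [/\ inG g1, inG g2,
    \int[mu]_x ((h g1 x - h g2 x) ^+ 2) <= 16 ^- q,
    net_label (t q) g1 = i & net_label (t q) g2 = i']); last first.
  apply: (outer_le_sub _ (level_prob_ge0 q) (outer_le0 P)).
  by move=> w [g1 [g2 [gg1 gg2 g12 [ki ki' _]]]]; apply: no; exists g1, g2.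
apply: (@outer_le_sub _ _ _ P _ [set w | 2 ^- q <
    `|Gn P Z n (cut (level n q) (fun x => h (r q g1) x - h (r q g2) x)) w| ] (level_prob q)) => //.
  by move=> w [? [? [_ _ _ [_ _]]]]; rewrite /= /r ki ki'.
set f := fun x => h (r q g1) x - h (r q g2) x.
have mf : measurable_fun setT f by apply: measurable_funB; apply: mh; exact: rG.
have fW x : `|f x| <= 2 * W x.
  apply: (le_trans (ler_normB _ _)).
  by have := hW x (rG q gg1); have := hW x (rG q gg2); lra.
have [mD1 D1 iD1 bD1] := hDi (net_label (t q) g1).
have [mD2 D2 iD2 bD2] := hDi (net_label (t q) g2).
have mhh g1' g2' : inG g1' -> inG g2' -> measurable_fun setT (fun x => h g1' x - h g2' x).
  by move=> ? ?; apply: measurable_funB; exact: mh.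
have hh2 g : inG g -> intg mu (fun x => (h g x - h (r q g) x) ^+ 2) /\
    \int[mu]_x ((h g x - h (r q g) x) ^+ 2) <= 2 * 16 ^- q.
  move=> gg; have [_ _ iDg bDg] := hDi (net_label (t q) g).
  apply: (@integral_sqr_le _ _ _ mu W _ (D q g)) => //.
  - by apply: mhh => //; exact: rG.
  - move=> x; apply: (le_trans (ler_normB _ _)).
    by have := hW x (rG q gg); have := hW x gg; lra.
  - by move=> x; exact: hD.
have [i1 b1] := hh2 _ gg1; have [i2 b2] := hh2 _ gg2.
have i12 : intg mu (fun x => (h g1 x - h g2 x) ^+ 2).
  apply: (le_intg _ (intgZ 4 iW2)) => [|x]; first by apply: measurable_funX; exact: mhh.
  rewrite ger0_norm ?sqr_ge0//.
  have := hW x gg1; have := hW x gg2; rewrite !ler_norml => /andP[? ?] /andP[? ?].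
  by have := W0 x; nra.
apply: level_tail => //.
- by apply: measurable_cut => //; exact: measurable_level.
- move=> x; apply: norm_cut_le => [|Ax]; first exact: level_bound_ge0.
  by rewrite (le_trans (fW x))// ler_pM2l.
apply: (@le_trans _ _ (\int[mu]_x (3 * ((h g1 x - h (r q g1) x) ^+ 2 +
    (h g2 x - h (r q g2) x) ^+ 2 + (h g1 x - h g2 x) ^+ 2)))).
  apply: Rintegral_le.
  - apply: (le_intg _ (intgZ 4 iW2)) => [|x].
      by apply: measurable_funX; apply: measurable_cut => //; exact: measurable_level.
    rewrite ger0_norm ?sqr_ge0//.
    have := fW x; have := norm_cut (level n q) f x; have := W0 x.
    rewrite -[_ ^+ 2]ger0_norm ?sqr_ge0// normrX.
    by have := normr_ge0 (cut (level n q) f x); nra.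
  - by apply: intgZ; apply: intgD => //; apply: intgD.
  - move=> x; apply: (@le_trans _ _ (f x ^+ 2)).
      by rewrite -[leRHS]real_normK ?num_real// -[leLHS]real_normK ?num_real// lerXn2r ?nnegrE// norm_cut.
    rewrite /f; move: (h g1 x) (h g2 x) (h (r q g1) x) (h (r q g2) x) => u1 u2 v1 v2.
    have := sqr_ge0 ((u1 - v1) + (u2 - v2)); have := sqr_ge0 ((u1 - v1) + (u1 - u2)).
    have := sqr_ge0 ((u2 - v2) - (u1 - u2)).
    by rewrite !expr2; nra.
rewrite RintegralZl//; last by apply: intgD => //; apply: intgD.
rewrite RintegralD//; last by apply: intgD.
rewrite RintegralD//.
have : 0 <= 16 ^- q :> R by rewrite invr_ge0 exprn_ge0.
by move: b1 b2 g12; lra.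
Qed.

Lemma intg_h g : inG g -> intg mu (h g).
Proof. by move=> gg; apply: (le_intg _ iW) => [|x]; [exact: mh|exact: hW]. Qed.

Lemma intg_hB g g' : inG g -> inG g' -> intg mu (fun x => h g x - h g' x).
Proof. by move=> gg g'g; apply: intgB; exact: intg_h. Qed.

Lemma intg_D q g : intg mu (D q g).
Proof.
case: (ht q) => _ /(_ (net_label (t q) g))[mD D0 _ _] _ _.
apply: (le_intg _ (intgZ 2 iW)) => // x.
by case/andP: (D0 x) => *; rewrite ger0_norm.
Qed.

Lemma D_ge0 q g x : 0 <= D q g x.
Proof. by case: (ht q) => _ /(_ (net_label (t q) g))[_ /(_ x)/andP[]]. Qed.

Let S n q g w := Gn P Z n (cut (level n q) (fun x => h g x - h (r q g) x)) w.

(** Where $\sqrt n\le cW$, the weight in the size of the bracket absorbs $\sqrt n$. *)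
Lemma sqrt_integral_cut n q g A (c : R) : measurable A -> 0 <= c ->
  (forall x, A x -> Num.sqrt n%:R <= c * W x) ->
  Num.sqrt n%:R * \int[mu]_x (cut A (D q g) x) <= c * 16 ^- q.
Proof.
move=> mA c0 hA; case: (ht q) => _ /(_ (net_label (t q) g))[mD D0 iD bD] _ _.
rewrite -RintegralZl//; last by apply: intg_cut => //; exact: intg_D.
apply: (@le_trans _ _ (\int[mu]_x (c * (D q g x * W x)))); last first.
  by rewrite RintegralZl// ler_wpM2l.
apply: Rintegral_le => //.
- by apply: intgZ; apply: intg_cut => //; exact: intg_D.
- exact: intgZ.
- move=> x; rewrite /cut indicE; have [/set_mem Ax|_] := boolP (x \in A).
    by rewrite mulr1 mulrC mulrCA ler_wpM2l ?D_ge0// hA.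
  by rewrite !mulr0 !mulr_ge0// D_ge0.
Qed.

Lemma chain_step n q g w : inG g ->
  `|Gn P Z n (cut (level n q `\` level n q.+1) (D q g)) w| <= 2 ^- q ->
  `|Gn P Z n (cut (level n q.+1) (fun x => h (r q.+1 g) x - h (r q g) x)) w| <= 2 ^- q ->
  `|S n q.+1 g w| <= 36 * 2 ^- q.+1 -> `|S n q g w| <= 36 * 2 ^- q.
Proof.
move=> gg h1 h2 h3.
set A := level n q `\` level n q.+1.
have mA : measurable A by apply: measurableD; exact: measurable_level.
have mL k : measurable (level n k) by exact: measurable_level.
have i1 : intg mu (cut A (fun x => h g x - h (r q g) x)).
  by apply: intg_cut => //; apply: intg_hB => //; exact: rG.
have i2 : intg mu (cut (level n q.+1) (fun x => h (r q.+1 g) x - h (r q g) x)).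
  by apply: intg_cut => //; apply: intg_hB => //; exact: rG.
have i3 : intg mu (cut (level n q.+1) (fun x => h g x - h (r q.+1 g) x)).
  by apply: intg_cut => //; apply: intg_hB => //; exact: rG.
(* Off [level n q.+1], [sqrt n <= 8^(q+1) W], so that [sqrt n] times the mean of the bracket is
   at most [8^(q+1) \int D W]; on it, pass to the next representative. *)
have -> : S n q g w = Gn P Z n (cut A (fun x => h g x - h (r q g) x)) w +
    (Gn P Z n (cut (level n q.+1) (fun x => h (r q.+1 g) x - h (r q g) x)) w + S n q.+1 g w).
  rewrite /S -GnD// -GnD//; last exact: intgD.
  congr (Gn _ _ _ _ _); apply/funext => x; rewrite /cut !indicE in_setD.
  have [/set_mem x1|_] /= := boolP (x \in level n q.+1).
    by rewrite mem_set/=; [ring|exact: level_subset].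
  by rewrite andbT; ring.
have e1 : 2 ^- q.+1 = 2 ^- q / 2 :> R by rewrite exprSr invfM.
apply: (le_trans (ler_normD _ _)); have := ler_normD
  (Gn P Z n (cut (level n q.+1) (fun x => h (r q.+1 g) x - h (r q g) x)) w) (S n q.+1 g w).
have iF : intg mu (cut A (D q g)) by apply: intg_cut => //; exact: intg_D.
have := @Gn_dominated _ _ _ P _ _ Z n _ _ w i1 iF.
move=> /(_ _)/wrap[x|h4].
  apply: norm_cut_le => [|Ax].
    by rewrite /cut mulr_ge0 ?D_ge0.
  by rewrite /cut indicE mem_set// mulr1 hD.
have := @sqrt_integral_cut n q g A (8 ^+ q.+1) mA (exprn_ge0 _ (ler0n _ 8)).
move=> /(_ _)/wrap[x [_ /= /negP]|h5].
  rewrite -ltNge ltr_pdivrMr ?exprn_gt0// => /ltW; by rewrite mulrC.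
have e2 : 8 ^+ q.+1 * 16 ^- q = 8 * 2 ^- q :> R.
  have -> : 16 ^+ q = 2 ^+ q * 8 ^+ q :> R by rewrite -exprMn; congr (_ ^+ _); ring.
  have n2 : (2 : R) ^+ q != 0 by rewrite expf_neq0.
  have n8 : (8 : R) ^+ q != 0 by rewrite expf_neq0.
  by rewrite exprS; field; rewrite n2 n8.
(* The constant 36 solves $x=1+16+1+x/2$: fluctuation of the bracket, twice its scaled mean
   $8\cdot2^{-q}$, the link, and the bound at the next level. *)
move: h5 h3; rewrite e2 e1; have := ler_norm (Gn P Z n (cut A (D q g)) w).
by move: h1 h2 h4; rewrite -/A; lra.
Qed.

Lemma sqrt_le_pow8 n : Num.sqrt n%:R * 16 ^- n <= 2 ^- n :> R.
Proof.
have -> : 16 ^+ n = 2 ^+ n * 8 ^+ n :> R by rewrite -exprMn; congr (_ ^+ _); ring.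
rewrite invfM mulrCA ler_piMr ?invr_ge0 ?exprn_ge0//.
rewrite ler_pdivrMr ?exprn_gt0// mul1r.
apply: (@le_trans _ _ n%:R).
  case: n => [|n]; first by rewrite sqrtr0.
  have s1 : 1 <= Num.sqrt n.+1%:R :> R by rewrite -[leLHS]sqrtr1 ler_wsqrtr// ler1n.
  by rewrite -[leRHS]sqr_sqrtr// expr2 ler_peMl// (le_trans _ s1).
by rewrite -natrX ler_nat ltnW// ltn_expl.
Qed.

(** The chain may stop at level [n]: as [W] is at least 1, $\sqrt n$ times the mean of the bracket
    is at most $\sqrt n\,16^{-n}\le2^{-n}$. *)
Lemma chain_end n g w : inG g ->
  `|Gn P Z n (cut (level n n) (D n g)) w| <= 2 ^- n -> `|S n n g w| <= 36 * 2 ^- n.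
Proof.
move=> gg h1; have mL : measurable (level n n) by exact: measurable_level.
have iF : intg mu (cut (level n n) (D n g)) by apply: intg_cut => //; exact: intg_D.
have i1 : intg mu (cut (level n n) (fun x => h g x - h (r n g) x)).
  by apply: intg_cut => //; apply: intg_hB => //; exact: rG.
have := @Gn_dominated _ _ _ P _ _ Z n _ _ w i1 iF.
move=> /(_ _)/wrap[x|h4].
  apply: norm_cut_le => [|Ax].
    by rewrite /cut mulr_ge0 ?D_ge0.
  by rewrite /cut indicE mem_set// mulr1 hD.
have := @sqrt_integral_cut n n g (level n n) (Num.sqrt n%:R) mL (sqrtr_ge0 _).
move=> /(_ _)/wrap[x _|h5]; first by rewrite ler_peMr ?sqrtr_ge0.
have := sqrt_le_pow8 n; have := ler_norm (Gn P Z n (cut (level n n) (D n g)) w).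
have : 0 <= 2 ^- n :> R by rewrite invr_ge0 exprn_ge0.
by rewrite -/(S n n g w) in h4; move: h1 h4 h5; lra.
Qed.

Lemma chain n q g w : (q <= n)%N -> inG g ->
  (forall k, (q <= k < n)%N ->
    `|Gn P Z n (cut (level n k `\` level n k.+1) (D k g)) w| <= 2 ^- k) ->
  `|Gn P Z n (cut (level n n) (D n g)) w| <= 2 ^- n ->
  (forall k, (q <= k < n)%N ->
    `|Gn P Z n (cut (level n k.+1) (fun x => h (r k.+1 g) x - h (r k g) x)) w| <= 2 ^- k) ->
  `|S n q g w| <= 36 * 2 ^- q.
Proof.
(* Induction on [n - q], from the finest level back to [q]. *)
move=> qn gg; rewrite -(subnK qn); move: (n - q)%N => m {qn n}.
elim: m q => [|m IH] q h1 h2 h3; first exact: chain_end.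
apply: chain_step => //.
- by apply: h1; rewrite leqnn addSn ltnS leq_addl.
- by apply: h3; rewrite leqnn addSn ltnS leq_addl.
- move: h1 h2 h3; rewrite addSnnS => h1 h2 h3; apply: IH => // k /andP[k1 k2].
    by apply: h1; rewrite k2 ltnW.
  by apply: h3; rewrite k2 ltnW.
Qed.

Lemma outer_le_markov (X : Omega -> R) (c : R) : 0 < c -> intg P X ->
  (forall w, 0 <= X w) -> outer_le P [set w | c < X w] ((\int[P]_w X w) / c).
Proof.
move=> c0 iX X0; have mX := intg_measurable iX.
have mB : measurable [set w | c < X w].
  have := mX measurableT _ (measurable_itv `]c, +oo[).
  by congr (measurable _); apply/seteqP; split=> w /=; rewrite ?in_itv/= ?andbT => -[].
exists [set w | c < X w] => //; split=> //.
have -> : (P [set w | (c < X w)%R] = \int[P]_w (\1_[set w | (c < X w)%R] w)%:E)%E.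
  by rewrite integral_indic// setIT.
rewrite EFinM lee_pdivlMr// muleC -ge0_integralZl//; last 2 first.
- by apply/measurable_EFinP; exact: measurable_indic.
- by rewrite lee_fin ltW.
rewrite -Rintegral_EFin//; apply: ge0_le_integral => //.
- by move=> w _; rewrite mule_ge0// lee_fin// ltW.
- by apply/measurable_EFinP; apply: measurable_funM => //; exact: measurable_indic.
- by apply/measurable_EFinP.
- move=> w _; rewrite -EFinM lee_fin indicE.
  by have [/set_mem /= /ltW|_] := boolP (w \in _); rewrite ?mulr1// mulr0.
Qed.

Let V n q := cut (~` level n q) (fun x => 2 * W x).

Let mlevelC n q : measurable (~` level n q).
Proof. by apply: measurableC; exact: measurable_level. Qed.

Let iV n q : intg mu (V n q).
Proof. by apply: intg_cut => //; exact: intgZ. Qed.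

Let V0 n q x : 0 <= V n q x.
Proof. by rewrite /V /cut !mulr_ge0. Qed.

(** The variable is nonnegative, as it dominates the process at the zero function, and its mean is
    $2\sqrt n\int V$. Off the level $\sqrt n\le8^qW$, so this mean is at most $4\cdot8^q$ times the
    integral of the cut $W^2$; Markov's inequality divides by $2^{-q}$. *)
Lemma rem_event n q :
  outer_le P [set w | 2 ^- q < Gn P Z n (V n q) w + 2 * Num.sqrt n%:R * \int[mu]_x V n q x]
    (4 * 16 ^+ q * \int[mu]_x cut (~` level n q) (fun x => W x ^+ 2) x).
Proof.
set c := 2 * Num.sqrt n%:R * _.
have iGn : intg P (Gn P Z n (V n q)).
  apply: intgZ; apply: intg_sum => j _; apply: intgB; last exact: intg_cst.
  exact: (intg_comp HZid _ (iV n q)).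
have iX : intg P (fun w => Gn P Z n (V n q) w + c) by apply: intgD => //; exact: intg_cst.
have X0 w : 0 <= Gn P Z n (V n q) w + c.
  apply: le_trans (@Gn_dominated _ _ _ P _ _ Z n (cst 0) (V n q) w _ (iV n q) _).
  - exact: normr_ge0.
  - exact: intg_cst.
  - by move=> x; rewrite normr0.
have p2 : 0 < 2 ^- q :> R by rewrite invr_gt0 exprn_gt0.
apply: outer_le_sub (outer_le_markov p2 iX X0) => //.
rewrite RintegralD//; last exact: intg_cst.
rewrite Rintegral_cst1.
have -> : \int[P]_w Gn P Z n (V n q) w = 0.
  rewrite /Gn RintegralZl//; last first.
    apply: intg_sum => j _; apply: intgB; last exact: intg_cst.
    exact: (intg_comp HZid _ (iV n q)).
  have sum0 m : \int[P]_w (\sum_(j < m) (V n q (Z j w) - \int[mu]_x V n q x)) = 0.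
    elim: m => [|m IH].
      by under eq_Rintegral do rewrite big_ord0; rewrite Rintegral_cst1.
    under eq_Rintegral do rewrite big_ord_recr/=.
    rewrite RintegralD//; last 2 first.
    - apply: intg_sum => j _; apply: intgB; last exact: intg_cst.
      exact: (intg_comp HZid _ (iV n q)).
    - by apply: intgB; [exact: (intg_comp HZid _ (iV n q))|exact: intg_cst].
    rewrite IH RintegralB//; last 2 first.
    - exact: (intg_comp HZid _ (iV n q)).
    - exact: intg_cst.
    by rewrite (Rintegral_cst1 P) (Rintegral_comp HZid m (iV n q)) subrr addr0.
  by rewrite sum0 mulr0.
rewrite add0r /c invrK.
have n2 : (2 : R) ^+ q != 0 by rewrite expf_neq0.
have -> : 16 ^+ q = 8 ^+ q * 2 ^+ q :> R by rewrite -exprMn; congr (_ ^+ _); ring.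
rewrite mulrA [leRHS]mulrAC ler_pM2r ?exprn_gt0//.
have -> : 4 * 8 ^+ q = 2 * (2 * 8 ^+ q) :> R by ring.
rewrite -!mulrA ler_pM2l// -RintegralZl; [|by []|exact: iV].
have iW2c : intg mu (cut (~` level n q) (fun x => W x ^+ 2)) by apply: intg_cut.
rewrite mulrA -RintegralZl//; apply: Rintegral_le; [exact: intgZ|exact: intgZ|].
move=> x; rewrite /V /cut indicE; have [/set_mem /=|_] := boolP (x \in _); last by rewrite !mulr0.
rewrite /level/= => /negP; rewrite -ltNge ltr_pdivrMr ?exprn_gt0// => /ltW sW.
by have := ler_wpM2r (W0 x) sW; rewrite !mulr1 expr2; lra.
Qed.

Lemma rem_cvg0 q (e : R) : 0 < e ->
  \forall n \near \oo, \int[mu]_x cut (~` level n q) (fun x => W x ^+ 2) x < e.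
Proof.
move=> e0.
have mW2 : measurable_fun setT (fun x => W x ^+ 2) by apply: measurable_funX.
have h1 : (\int[mu]_x (cut (~` level n q) (fun x => W x ^+ 2) x)%:E @[n --> \oo] -->
    \int[mu]_x (cst 0 x))%E.
  apply: (dominated_cvg _ _ _ _ iW2) => //.
  - by move=> n; apply/measurable_EFinP; apply: measurable_cut.
  - move=> x _; apply: cvg_near_cst.
    (* Once $n\ge(8^qW(x))^2$ the point [x] lies in [level n q]. *)
    have [n0 hn0] : exists n0 : nat, (W x * 8 ^+ q) ^+ 2 <= n0%:R.
      by exists (Num.truncn ((W x * 8 ^+ q) ^+ 2)).+1; rewrite ltW// truncnS_gt.
    exists n0 => //= n /= n0n; congr EFin; rewrite /cut indicE memNset ?mulr0//=.
    apply; rewrite /level/= ler_pdivlMr ?exprn_gt0//.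
    rewrite -[leLHS]ger0_norm ?mulr_ge0 ?exprn_ge0// -sqrtr_sqr ler_wsqrtr//.
    by rewrite (le_trans hn0)// ler_nat.
  - move=> n x _; rewrite lee_fin (le_trans (norm_cut _ _ _))//.
    by rewrite ger0_norm ?sqr_ge0.
rewrite integral0 in h1.
have /fine_cvgP[_ h2] := h1.
have /cvgr_lt/(_ e e0) := h2.
exact: filterS.
Qed.

(** [A] absorbs the cell counts against [level_prob]. The constant 74 is 36 + 36 for the two chains,
    plus 1 for the link of the representatives and 1 for the part off [level n q]. *)
Lemma chaining_bound n q (A : R) : (0 < n)%N -> (q <= n)%N ->
  (forall k, [/\ (M k)%:R * level_prob k <= A * 2 ^- k,
    (M k)%:R * (M k)%:R * level_prob k <= A * 2 ^- k &
    (M k)%:R * (M k.+1)%:R * level_prob k <= A * 2 ^- k]) ->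
  outer_le P [set w | exists g1 g2, [/\ inG g1, inG g2,
      \int[mu]_x ((h g1 x - h g2 x) ^+ 2) <= 16 ^- q &
      74 * 2 ^- q < `|Gn P Z n (fun x => h g1 x - h g2 x) w| ]]
    (4 * 16 ^+ q * (\int[mu]_x cut (~` level n q) (fun x => W x ^+ 2) x) + 6 * A * 2 ^- q).
Proof.
move=> n0 qn MA.
have mL k : measurable (level n k) by exact: measurable_level.
pose bad k := [set w | exists g, inG g /\ 2 ^- k <
    `|Gn P Z n (cut (level n k `\` level n k.+1) (D k g)) w| ] `|`
  [set w | exists g, inG g /\ 2 ^- k <
    `|Gn P Z n (cut (level n k.+1) (fun x => h (r k.+1 g) x - h (r k g) x)) w| ].
have badP k : outer_le P (bad k) (A * 2 ^- k + A * 2 ^- k).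
  have [M1 M2 M3] := MA k; have mD : measurable (level n k `\` level n k.+1) by exact: measurableD.
  apply: outer_leU.
    exact: (outer_le_sub (@subset_refl _ _) M1 (@bracket_event n k _ n0 mD (@subDsetl _ _ _))).
  exact: (outer_le_sub (@subset_refl _ _) M3 (@link_event n k n0)).
have [Mq1 Mq2 _] := MA q; have [Mn1 _ _] := MA n.
have := outer_leU (rem_event n q) (outer_leU (outer_le_bigU (index_iota q n) badP)
  (outer_leU (outer_le_sub (@subset_refl _ _) Mn1 (bracket_event n0 (mL n) (@subset_refl _ _)))
    (outer_le_sub (@subset_refl _ _) Mq2 (pair_event q n0)))).
apply: outer_le_sub.
- move=> w [g1 [g2 [gg1 gg2 g12 big]]]; apply: contrapT => nbad.
  have nrem : Gn P Z n (V n q) w + 2 * Num.sqrt n%:R * \int[mu]_x V n q x <= 2 ^- q.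
    by rewrite leNgt; apply/negP => hh; apply: nbad; left.
  have nend g : inG g -> `|Gn P Z n (cut (level n n) (D n g)) w| <= 2 ^- n.
    move=> gg; rewrite leNgt; apply/negP => hh; apply: nbad; right; right; left.
    by exists g.
  have npair : `|Gn P Z n (cut (level n q) (fun x => h (r q g1) x - h (r q g2) x)) w| <= 2 ^- q.
    rewrite leNgt; apply/negP => hh; apply: nbad; right; right; right.
    by exists g1, g2.
  have nbadk k : (q <= k < n)%N -> ~ bad k w.
    move=> qkn hh; apply: nbad; right; left; rewrite -bigcup_seq; exists k => //=.
    by rewrite mem_index_iota.
  have Sle g : inG g -> `|S n q g w| <= 36 * 2 ^- q.
    move=> gg; apply: chain => //.
    - move=> k qkn; rewrite leNgt; apply/negP => hh; apply: (nbadk k qkn); left.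
      by exists g.
    - exact: nend.
    - move=> k qkn; rewrite leNgt; apply/negP => hh; apply: (nbadk k qkn); right.
      by exists g.
  pose f0 := cut (~` level n q) (fun x => h g1 x - h g2 x).
  pose f1 := cut (level n q) (fun x => h (r q g1) x - h (r q g2) x).
  pose s1 := cut (level n q) (fun x => h g1 x - h (r q g1) x).
  pose s2 := cut (level n q) (fun x => h g2 x - h (r q g2) x).
  have i0 : intg mu f0 by apply: intg_cut => //; exact: intg_hB.
  have i1 : intg mu f1 by apply: intg_cut => //; apply: intg_hB; exact: rG.
  have is1 : intg mu s1 by apply: intg_cut => //; apply: intg_hB => //; exact: rG.
  have is2 : intg mu s2 by apply: intg_cut => //; apply: intg_hB => //; exact: rG.
  have is2N : intg mu (fun x => - s2 x).
    by have := intgZ (-1) is2; under eq_fun do rewrite mulN1r.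
  have h0 : `|Gn P Z n f0 w| <= 2 ^- q.
    apply: le_trans nrem; apply: Gn_dominated => [||x]; [exact: i0|exact: iV|].
    apply: norm_cut_le => [|Ax]; first exact: V0.
    rewrite /V /cut indicE mem_set// mulr1 (le_trans (ler_normB _ _))//.
    by have := hW x gg1; have := hW x gg2; lra.
  (* Off [level n q] the difference is kept whole; on it, it runs through the two
     representatives. *)
  have E : Gn P Z n (fun x => h g1 x - h g2 x) w =
      Gn P Z n f0 w + (Gn P Z n f1 w + (S n q g1 w - S n q g2 w)).
    rewrite -[S n q g1 w]/(Gn P Z n s1 w) -[S n q g2 w]/(Gn P Z n s2 w).
    have i12 := intgD is1 is2N.
    rewrite -GnN// -GnD// -GnD// -GnD//; last exact: intgD.
    congr (Gn _ _ _ _ _); apply/funext => x; rewrite /f0 /f1 /s1 /s2 /cut !indicE in_setC.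
    by case: (_ \in _) => /=; ring.
  move: big; rewrite E ltNge => /negP; apply.
  apply: (le_trans (ler_normD _ _)).
  have := ler_normD (Gn P Z n f1 w) (S n q g1 w - S n q g2 w).
  have := ler_normB (S n q g1 w) (S n q g2 w).
  have := Sle _ gg1; have := Sle _ gg2.
  by rewrite -/f1 in npair; move: npair h0; lra.
- rewrite lerD2l.
  have A0 : 0 <= A.
    have [+ _ _] := MA 0%N; rewrite expr0 invr1 mulr1; apply: le_trans.
    by rewrite mulr_ge0// level_prob_ge0.
  (* The geometric sum contributes at most $4A2^{-q}$, and the events at levels [n] and [q] at most
     $A2^{-q}$ each. *)
  have -> : \sum_(q <= k < n) (A * 2 ^- k + A * 2 ^- k) = 4 * A * (2 ^- q - 2 ^- n).
    rewrite -(subnK qn); elim: (n - q)%N => [|m IH].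
      by rewrite add0n subrr mulr0 big_geq.
    rewrite addSn big_nat_recr ?leq_addl//= IH exprS invfM; field.
    by rewrite !expf_neq0.
  have : 0 <= A * 2 ^- n by rewrite mulr_ge0// invr_ge0 exprn_ge0.
  have : 0 <= A * 2 ^- q by rewrite mulr_ge0// invr_ge0 exprn_ge0.
  by move: (2 ^- n) (2 ^- q) => u v; nra.
Qed.

End chaining.

(** * Asymptotic equicontinuity from brackets *)

Section equicontinuity.
Context {R : realType} {dO : measure_display} {Omega : measurableType dO}
  (P : probability Omega R) {dT : measure_display} {T : measurableType dT}
  (Z : nat -> {mfun Omega >-> T}).
Hypothesis HZind : mutually_independent P (fun j => (Z j : Omega -> T)).
Hypothesis HZid : identically_distributed P (fun j => (Z j : Omega -> T)).
Let mu : probability T R := distribution P (Z 0%N).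

Lemma level_prob_decay (B : nat) : exists2 A : R, 0 <= A &
  forall k, (B ^ k)%:R * (level_prob k : R) <= A * 2 ^- k.
Proof.
(* [expR y >= y ^ (p + 1) / (p + 1)!] with [2 B <= 4 ^ (p + 1)]. *)
pose p := (2 * B)%N.
have pB : (2 * B <= 4 ^ p.+1)%N by rewrite ltnW// (leq_trans (ltn_expl p (isT : 1 < 4)%N))// leq_exp2l.
pose c : R := 128 ^+ p.+1 * (p.+1)`!%:R.
have f0 : 0 < (p.+1)`!%:R :> R by rewrite ltr0n fact_gt0.
have c0 : 0 < c by rewrite mulr_gt0 ?exprn_gt0.
exists (2 * c); first by rewrite mulr_ge0// ltW.
move=> k; rewrite /level_prob expRN.
set y : R := 4 ^+ k / 128.
have y0 : 0 <= y by rewrite divr_ge0// exprn_ge0.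
have hy : y ^+ p.+1 / (p.+1)`!%:R <= expR y.
  by apply: le_trans (expR_ge1Dxn p y0); rewrite lerDr.
have key : (B ^ k)%:R * 2 ^+ k <= c * expR y.
  have -> : (B ^ k)%:R * 2 ^+ k = ((2 * B) ^ k)%:R :> R.
    by rewrite expnMn natrM mulrC -natrX.
  apply: (@le_trans _ _ (c * (y ^+ p.+1 / (p.+1)`!%:R))); last by rewrite ler_pM2l.
  have -> : c * (y ^+ p.+1 / (p.+1)`!%:R) = ((4 ^ p.+1) ^ k)%:R.
    rewrite /c /y expr_div_n -exprM -expnM mulnC natrX.
    by field; rewrite gt_eqF//= expf_neq0.
  by rewrite ler_nat; case: k {y y0 hy} => // k; rewrite leq_exp2r.
have e0 : 0 < expR y by exact: expR_gt0.
rewrite ler_pdivlMr ?exprn_gt0// mulrC mulrA mulrA ler_pdivrMr//.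
by move: key; lra.
Qed.

Context {Gam : Type} (g0 : Gam) (inG : Gam -> Prop) (h : Gam -> T -> R) (W : T -> R).

Theorem bracketed_equicontinuous : measurable_fun setT W -> (forall x, 1 <= W x) ->
  intg mu (fun x => W x ^+ 2) -> (forall g, inG g -> measurable_fun setT (h g)) ->
  (forall g x, inG g -> `|h g x| <= W x) ->
  bracketed mu inG W (fun g g' x => `|h g x - h g' x|) ->
  forall eps eta : R, 0 < eps -> 0 < eta -> exists2 delta : R, 0 < delta &
  \forall n \near \oo, outer_le P [set w | exists g1 g2, [/\ inG g1, inG g2,
      \int[mu]_x ((h g1 x - h g2 x) ^+ 2) <= delta &
      eps < `|Gn P Z n (fun x => h g1 x - h g2 x) w| ]] eta.
Proof.
move=> mW W1 iW2 mh hW hb eps eta eps0 eta0.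
have W0 x : 0 <= W x by rewrite (le_trans _ (W1 x)).
have [C [B [t ht]]] := bracketed_net g0 mW W0 hW hb.
pose M q := (C * B ^ q)%N.
have [A [A0 MA]] : exists A : R, 0 <= A /\ forall k, [/\ (M k)%:R * (level_prob k : R) <= A * 2 ^- k,
    (M k)%:R * (M k)%:R * (level_prob k : R) <= A * 2 ^- k &
    (M k)%:R * (M k.+1)%:R * (level_prob k : R) <= A * 2 ^- k].
  (* [B] serves for a single cell count, [B * B] for the products of two counts. *)
  have [A1 A10 h1] := level_prob_decay B; have [A2 A20 h2] := level_prob_decay (B * B).
  pose c1 := (C%:R * A1 : R); pose c2 := (C * C)%:R * A2 : R; pose c3 := (C * C * B)%:R * A2 : R.
  have c10 : 0 <= c1 by rewrite mulr_ge0.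
  have c20 : 0 <= c2 by rewrite mulr_ge0.
  have c30 : 0 <= c3 by rewrite mulr_ge0.
  exists (c1 + c2 + c3); split; first by rewrite !addr_ge0.
  move=> k; have k0 : 0 <= 2 ^- k :> R by rewrite invr_ge0 exprn_ge0.
  have a1 := mulr_ge0 c10 k0; have a2 := mulr_ge0 c20 k0; have a3 := mulr_ge0 c30 k0.
  rewrite -!natrM !mulrDl; split.
  - have h3 : (C * B ^ k)%:R * level_prob k <= c1 * 2 ^- k.
      by rewrite natrM -mulrA /c1 -mulrA ler_wpM2l.
    by apply: (le_trans h3); lra.
  - have -> : (M k * M k = C * C * (B * B) ^ k)%N by rewrite /M expnMn mulnACA.
    have h3 : (C * C * (B * B) ^ k)%:R * level_prob k <= c2 * 2 ^- k.
      by rewrite natrM -mulrA /c2 -mulrA ler_wpM2l.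
    by apply: (le_trans h3); lra.
  - have -> : (M k * M k.+1 = C * C * B * (B * B) ^ k)%N.
      by rewrite /M expnS expnMn mulnACA -!mulnA; congr (C * (C * _))%N; rewrite mulnCA.
    have h3 : (C * C * B * (B * B) ^ k)%:R * level_prob k <= c3 * 2 ^- k.
      by rewrite natrM -mulrA /c3 -mulrA ler_wpM2l.
    by apply: (le_trans h3); lra.
have [q hq1 hq2] : exists2 q : nat, 74 * 2 ^- q <= eps & 6 * A * 2 ^- q <= eta / 2.
  (* As $a\le2^q$ for the [q] below, $2^q$ exceeds both quotients, which are the two
     requirements. *)
  pose a := 74 / eps + 12 * A / eta.
  pose q := (Num.truncn a).+1.
  have aq : a <= 2 ^+ q.
    rewrite (le_trans (ltW (truncnS_gt a)))// -natrX ler_nat; apply/ltnW; exact: ltn_expl.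
  have q1 : 0 <= 74 / eps by rewrite divr_ge0// ltW.
  have q2 : 0 <= 12 * A / eta by rewrite divr_ge0 ?mulr_ge0// ltW.
  have a1 : 74 / eps <= 2 ^+ q by apply: le_trans aq; rewrite lerDl.
  have a2 : 12 * A / eta <= 2 ^+ q by apply: le_trans aq; rewrite lerDr.
  exists q.
  - by rewrite ler_pdivrMr ?exprn_gt0//; move: a1; rewrite ler_pdivrMr// mulrC.
  - by rewrite ler_pdivrMr ?exprn_gt0//; move: a2; rewrite ler_pdivrMr// mulrC; lra.
exists (16 ^- q); first by rewrite invr_gt0 exprn_gt0.
(* Multiplied by the factor $4\cdot16^q$ of [chaining_bound] this is [eta / 2]. With [q] now fixed,
   letting [n] grow makes the truncated part this small. *)
have e0 : 0 < eta / (8 * 16 ^+ q) by rewrite divr_gt0 ?mulr_gt0 ?exprn_gt0.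
have rem := rem_cvg0 mW W1 iW2 q e0.
near=> n.
have n0 : (0 < n)%N by near: n; exists 1%N.
have qn : (q <= n)%N by near: n; exists q.
apply: outer_le_sub (chaining_bound HZind HZid mW W1 iW2 mh hW ht n0 qn MA).
- by move=> w [g1 [g2 [gg1 gg2 g12 big]]]; exists g1, g2; split=> //; exact: le_lt_trans big.
- have : \int[mu]_x cut (~` level W n q) (fun x => W x ^+ 2) x < eta / (8 * 16 ^+ q).
    by near: n; exact: rem.
  rewrite ltr_pdivlMr ?mulr_gt0 ?exprn_gt0// => h4.
  by move: hq2; lra.
Unshelve. all: by end_near. Qed.

End equicontinuity.

(** * Monotone families *)

Section monotone.
Context {R : realType} {d : measure_display} {T : measurableType d}
  (mu : probability T R) (W : T -> R).
Hypothesis mW : measurable_fun setT W.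
Hypothesis W0 : forall x, 0 <= W x.

(** If [S] has a maximum, a constant sequence works. Otherwise every point of [S] is followed by a
    rational and a further point of [S]; so it suffices to choose, for each rational, a point of [S]
    above it when there is one. Running maxima make the sequence monotone. *)
Lemma cofinal_sequence (S : set R) : S !=set0 -> exists y : nat -> R,
  [/\ forall n, S (y n), forall n m, (n <= m)%N -> y n <= y m &
      forall s, S s -> exists n, s <= y n].
Proof.
move=> [s0 Ss0].
have [y [yS ycof]] : exists y : nat -> R, (forall n, S (y n)) /\
    forall s, S s -> exists n, s <= y n.
  have [[m Sm hm]|nomax] := pselect (exists2 m, S m & forall s, S s -> s <= m).
    by exists (fun=> m); split=> // s Ss; exists 0%N; exact: hm.
  pose q n : R := ratr (odflt 0 (unpickle n)).
  have /choice[y hy] n : exists s, S s /\ forall s', S s' -> q n <= s' -> q n <= s.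
    have [[s Ss qs]|no] := pselect (exists2 s, S s & q n <= s); first by exists s.
    by exists s0; split=> // s' Ss' qs'; case: no; exists s'.
  exists y; split=> [n|s Ss]; first by case: (hy n).
  have [s' Ss' ss'] : exists2 s', S s' & s < s'.
    apply: contrapT => no; apply: nomax; exists s => // s' Ss'.
    by rewrite leNgt; apply/negP => ss'; apply: no; exists s'.
  have [r /[!in_itv]/= /andP[sr rs']] := rat_in_itvoo ss'.
  exists (pickle r); apply: (le_trans (ltW sr)).
  have := (hy (pickle r)).2 _ Ss'; rewrite /q pickleK/=; apply; exact: ltW.
pose z := fix z n := if n is m.+1 then Num.max (z m) (y m.+1) else y 0%N.
have zS n : S (z n) by elim: n => //= n Sn; rewrite maxEle; case: ifP.
exists z; split=> //.
  by apply/nondecreasing_seqP => n /=; rewrite le_max lexx.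
move=> s /ycof[n sn]; exists n; apply: (le_trans sn).
by case: n {sn} => //= n; rewrite le_max lexx orbT.
Qed.

Lemma monotone_bracket (S : set R) (f : R -> T -> R) (H : T -> R) (b : R) :
  S !=set0 -> (forall s s' x, s <= s' -> f s x <= f s' x) ->
  (forall s, S s -> measurable_fun setT (f s)) ->
  (forall s x, S s -> 0 <= f s x <= H x) ->
  intg mu (fun x => H x * W x) ->
  (forall s s', S s -> S s' ->
     \int[mu]_x (f s x * W x) - \int[mu]_x (f s' x * W x) <= b) ->
  exists D : T -> R, [/\ measurable_fun setT D, forall x, 0 <= D x,
    intg mu (fun x => D x * W x), \int[mu]_x (D x * W x) <= b &
    forall s s' x, S s -> S s' -> `|f s x - f s' x| <= D x].
Proof.
move=> S0 fmono mf fH iHW fb.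
(* The supremum over the cell may fail to be measurable a priori; monotonicity reduces it to the
   limit along cofinal and coinitial sequences. *)
have [y [yS ymono ycof]] := cofinal_sequence S0.
have [z [zS zmono zcof]] : exists z : nat -> R,
  [/\ forall n, S (z n), forall n m, (n <= m)%N -> z m <= z n &
      forall s, S s -> exists n, z n <= s].
  have [|z [zS zmono zcof]] := @cofinal_sequence (-%R @` S).
    by case: S0 => s Ss; exists (- s); exists s.
  exists (fun n => - z n); split.
  - by move=> n; have [s Ss <-] := zS n; rewrite opprK.
  - by move=> n m nm; rewrite lerN2 zmono.
  - move=> s Ss; have [|n sn] := zcof (- s); first by exists s.
    by exists n; rewrite lerNl.
pose u n x := f (y n) x - f (z n) x.
have umono x : nondecreasing_seq (u ^~ x).
  by move=> n m nm; rewrite /u lerB// fmono// ?ymono ?zmono.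
have uH n x : u n x <= H x.
  by have /andP[_ ?] := fH _ x (yS n); have /andP[? _] := fH _ x (zS n); rewrite /u; lra.
have uub x : has_ubound (range (u ^~ x)) by exists (H x) => _ [n _ <-].
pose D x := sup (range (u ^~ x)).
have ucvg x : u ^~ x @ \oo --> D x by exact: nondecreasing_cvgn.
have uD n x : u n x <= D x by apply: ub_le_sup => //; exists n.
have DH x : D x <= H x by apply: ge_sup => [|_ [n _ <-] //]; exists (u 0%N x), 0%N.
have key s s' x : S s -> S s' -> f s x - f s' x <= D x.
  move=> /ycof[n sn] /zcof[m ms']; apply: le_trans (uD (maxn n m) x).
  rewrite /u lerB// fmono//; first by rewrite (le_trans sn)// ymono// leq_maxl.
  by rewrite (le_trans _ ms')// zmono// leq_maxr.
have D0 x : 0 <= D x by rewrite -(subrr (f (y 0%N) x)) key.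
have mu_ n : measurable_fun setT (u n) by apply: measurable_funB; exact: mf.
have mD : measurable_fun setT D by apply: (@measurable_fun_cvg _ _ _ _ u).
have iDW : intg mu (fun x => D x * W x).
  apply: (le_intg _ iHW) => [|x]; first exact: measurable_funM.
  by rewrite ger0_norm ?mulr_ge0// ler_wpM2r.
have ifW s : S s -> intg mu (fun x => f s x * W x).
  move=> Ss; apply: (le_intg _ iHW) => [|x]; first by apply: measurable_funM => //; exact: mf.
  have /andP[f0 fHx] := fH s x Ss.
  by rewrite ger0_norm ?mulr_ge0// ler_wpM2r.
exists D; split=> //.
(* The cell bound holds for each pair [y n], [z n] and passes to the limit by dominated
   convergence. *)
- have h1 : (\int[mu]_x (u n x * W x)%:E @[n --> \oo] --> \int[mu]_x (D x * W x)%:E)%E.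
    apply: (dominated_cvg _ _ _ _ iHW) => //.
    + by move=> n; apply/measurable_EFinP; apply: measurable_funM.
    + move=> x _; apply: cvg_EFin; first by near=> n.
      apply: cvgMl; exact: ucvg.
    + move=> n x _; rewrite /= lee_fin.
      rewrite normrM (ger0_norm (W0 x)) ler_wpM2r// ler_norml uH andbT.
      have /andP[fy _] := fH _ x (yS n); have /andP[_ fz] := fH _ x (zS n).
      by rewrite /u; lra.
  rewrite -lee_fin -Rintegral_EFin// -(cvg_lim _ h1)//.
  apply: lime_le; first by apply/cvg_ex; eexists; exact: h1.
  near=> n; under eq_integral do rewrite mulrBl.
  rewrite Rintegral_EFin; last by apply: intgB; exact: ifW.
  by rewrite lee_fin RintegralB//; [exact: fb|exact: ifW|exact: ifW].
- move=> s s' x Ss Ss'; rewrite ler_norml lerNl opprB; apply/andP; split; exact: key.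
Unshelve. all: by end_near. Qed.

Lemma bracketed_monotone (Gam : Type) (inG : Gam -> Prop) (c : Gam -> R)
    (f : R -> T -> R) (H : T -> R) :
  (forall s s' x, s <= s' -> f s x <= f s' x) ->
  (forall g, inG g -> measurable_fun setT (f (c g))) ->
  (forall g x, inG g -> 0 <= f (c g) x <= H x) ->
  intg mu (fun x => H x * W x) ->
  bracketed mu inG W (fun g g' x => `|f (c g) x - f (c g') x|).
Proof.
move=> fmono mf fH iHW.
have HW0 g : inG g -> 0 <= \int[mu]_x (f (c g) x * W x) <= \int[mu]_x (H x * W x).
  move=> gg; apply/andP; split.
    by apply: Rintegral_ge0 => x _; have /andP[? _] := fH g x gg; rewrite mulr_ge0.
  apply: Rintegral_le => // [|x]; last by have /andP[_ ?] := fH g x gg; rewrite ler_wpM2r.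
  apply: (le_intg _ iHW) => [|x]; first by apply: measurable_funM => //; exact: mf.
  have /andP[f0 fHx] := fH g x gg.
  by rewrite ger0_norm ?mulr_ge0// ler_wpM2r.
set v := \int[mu]_x (H x * W x) in HW0.
(* Adding 1 makes [V] positive and larger than every integral, so that labels stay below the number
   of cells. *)
pose V : R := `|v| + 1; have V0 : 0 < V by rewrite ltr_wpDl.
exists 1%N, 1%N, V; split; first exact: ltW.
move=> [//|N] _; pose a g : R := N.+1%:R / V * \int[mu]_x (f (c g) x * W x).
have a_ge0 g : inG g -> 0 <= a g.
  by move=> gg; have /andP[? _] := HW0 g gg; rewrite mulr_ge0// divr_ge0// ltW.
have tr_le g : inG g -> (Num.truncn (a g))%:R <= a g by move=> gg; rewrite truncn_le a_ge0.
have a_lt g : inG g -> (Num.truncn (a g) < N.+1)%N.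
  move=> gg; have /andP[m0 mv] := HW0 g gg.
  rewrite -(ltr_nat R) (le_lt_trans (tr_le g gg))// /a mulrAC ltr_pdivrMr//.
  by rewrite ltr_pM2l// (le_lt_trans mv)// /V (le_lt_trans (ler_norm _))// ltrDl.
pose k g : 'I_N.+1 := inord (Num.truncn (a g)).
have /choice[D hD] (i : 'I_N.+1) : exists Di : T -> R, [/\ measurable_fun setT Di, forall x, 0 <= Di x,
    intg mu (fun x => Di x * W x), \int[mu]_x (Di x * W x) <= V / N.+1%:R &
    forall s s' x, [set c g | g in [set g | inG g /\ k g = i]] s ->
      [set c g | g in [set g | inG g /\ k g = i]] s' -> `|f s x - f s' x| <= Di x].
  (* An empty cell receives the zero bracket. *)
  have [[g [gg kg]]|no] := pselect (exists g, inG g /\ k g = i); last first.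
    exists (cst 0); split=> //.
    - by under [X in intg _ X]eq_fun do rewrite mul0r; exact: intg_cst.
    - by under eq_Rintegral do rewrite mul0r; rewrite Rintegral_cst1 divr_ge0// ltW.
    - by move=> s s' x [g' /= [? ?]]; case: no; exists g'.
  apply: (@monotone_bracket _ f H) => //.
  - by exists (c g); exists g.
  - by move=> _ [g' /= [? _] <-]; exact: mf.
  - by move=> _ x [g' /= [? _] <-]; exact: fH.
  - move=> _ _ [g1 /= [gg1 k1] <-] [g2 /= [gg2 k2] <-].
    have e : Num.truncn (a g1) = Num.truncn (a g2).
      have := congr1 val (etrans k1 (esym k2)).
      by rewrite /= !inordK// a_lt.
    rewrite ler_pdivlMr//.
    have h1 := tr_le _ gg2; have h2 := truncnS_gt (a g1).
    (* Equal integer parts put the values of [a] at most 1 apart, hence the integrals at most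
       [V / N.+1]. *)
    have : a g1 - a g2 <= 1 by rewrite -e in h1; move: h1 h2; rewrite -natr1; lra.
    by rewrite /a -mulrBr mulrAC ler_pdivrMr// mul1r mulrC.
exists 'I_N.+1, k, D; split.
- by rewrite card_ord mul1n expn1.
- by move=> i; have [? ? ? ? _] := hD i; split.
- move=> g g' gg g'g kg x; have [_ _ _ _ h] := hD (k g).
  by apply: h; [exists g|exists g'].
Qed.

End monotone.

(** * Linear functionals: measurability and boundedness *)

Section linear_functionals.
Context {R : realType}.

Lemma linear_functional_sum (p : nat) (f : 'rV[R]_p -> R) : linear_functional f ->
  forall u, f u = \sum_(j < p) u 0 j * f (delta_mx 0 j).
Proof.
move=> lf u.
have f0 : f 0 = 0 by have := lf (-1) 0 0; rewrite scaler0 addr0 mulN1r addNr.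
rewrite {1}[u]row_sum_delta.
elim: (index_enum _) => [|j s IH]; first by rewrite !big_nil.
by rewrite !big_cons lf IH.
Qed.

Lemma linear_functionalD (p : nat) (f : 'rV[R]_p -> R) : linear_functional f ->
  forall u v, f (u + v) = f u + f v.
Proof. by move=> lf u v; have := lf 1 u v; rewrite scale1r mul1r. Qed.

Lemma linear_functional_comp (p q : nat) (A : 'rV[R]_p -> 'rV[R]_q) (f : 'rV[R]_q -> R) :
  linear_map A -> linear_functional f -> linear_functional (f \o A).
Proof. by move=> lA lf c u v; rewrite /= lA lf. Qed.

Lemma measurable_coord (p : nat) (j : 'I_p) :
  measurable_fun (setT : set (Rvec R p)) (fun u : Rvec R p => (u : 'rV[R]_p) 0 j).
Proof.
apply: (measurability (@RGenOInfty.G R)) => [|/= _ [_] [r] -> <-].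
  exact: RGenOInfty.measurableE.
rewrite setTI; apply: sub_sigma_algebra.
apply: (@open_comp _ _ (fun u : 'rV[R]_p => u 0 j)); last exact: interval_open.
by move=> u _; exact: coord_continuous.
Qed.

Lemma measurable_linear_functional (p : nat) (f : 'rV[R]_p -> R) : linear_functional f ->
  measurable_fun (setT : set (Rvec R p)) (f : Rvec R p -> R).
Proof.
move=> lf; rewrite (_ : (f : Rvec R p -> R) =
    fun u : Rvec R p => \sum_(j < p) (u : 'rV[R]_p) 0 j * f (delta_mx 0 j)); last first.
  by apply/funext => u; exact: linear_functional_sum.
by apply: measurable_sum => j; apply: measurable_funM => //; exact: measurable_coord.
Qed.

Lemma bounded_linear_functional (p : nat) (f : 'rV[R]_p -> R) (A : set 'rV[R]_p) :
  linear_functional f -> compact A -> exists c : R, forall u, A u -> `|f u| <= c.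
Proof.
move=> lf cA.
have /choice[c hc] (j : 'I_p) : exists c : R, forall u, A u -> `|u 0 j| <= c.
  have cj : compact ((fun u : 'rV[R]_p => u 0 j) @` A).
    apply: continuous_compact cA; apply: continuous_subspaceT => u.
    exact: coord_continuous.
  have [M [_ hM]] := compact_bounded cj.
  by exists (M + 1) => u Au; apply: (hM (M + 1)); [rewrite ltrDl|exists u].
exists (\sum_(j < p) c j * `|f (delta_mx 0 j)|) => u Au.
rewrite (linear_functional_sum lf) (le_trans (ler_norm_sum _ _ _))//.
by apply: ler_sum => j _; rewrite normrM ler_wpM2r// hc.
Qed.

End linear_functionals.

(** * Change of variables between [P] and the law of [X] *)

Section transfer.
Context {R : realType} {dO : measure_display} {Omega : measurableType dO}
  (P : probability Omega R) {dT : measure_display} {T : measurableType dT}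
  (X : {mfun Omega >-> T}).
Implicit Types f : T -> R.

Lemma intg_distribution f : measurable_fun setT f ->
  intg P (fun w => f (X w)) -> intg (distribution P X) f.
Proof.
move=> mf /integrableP[_ fi]; apply/integrableP; split; first exact/measurable_EFinP.
rewrite ge0_integral_distribution//.
by apply: measurableT_comp => //; exact/measurable_EFinP.
Qed.

Lemma distribution_intg f : intg (distribution P X) f -> intg P (fun w => f (X w)).
Proof.
move=> iF; have mf := intg_measurable iF; move: iF => /integrableP[_ fi].
apply/integrableP; split.
  by apply/measurable_EFinP; exact: measurableT_comp.
rewrite ge0_integral_distribution// in fi.
by apply: measurableT_comp => //; exact/measurable_EFinP.
Qed.

End transfer.

(** * Square integrability and the $L^2$ norm *)

Section square_integrability.
Context {R : realType} {d : measure_display} {T : measurableType d}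
  (mu : probability T R).

Lemma intg_sqrD (f g : T -> R) : measurable_fun setT f -> measurable_fun setT g ->
  intg mu (fun x => f x ^+ 2) -> intg mu (fun x => g x ^+ 2) ->
  intg mu (fun x => (f x + g x) ^+ 2).
Proof.
move=> mf mg if2 ig2; apply: (le_intg _ (intgZ 2 (intgD if2 ig2))) => [|x].
  by apply: measurable_funX; exact: measurable_funD.
rewrite ger0_norm ?sqr_ge0//; have := sqr_ge0 (f x - g x); rewrite !expr2; nra.
Qed.

Lemma intg_sqr_sum (I : eqType) (s : seq I) (f : I -> T -> R) :
  (forall i, measurable_fun setT (f i)) -> (forall i, intg mu (fun x => f i x ^+ 2)) ->
  intg mu (fun x => (\sum_(i <- s) f i x) ^+ 2).
Proof.
move=> mf if2; elim: s => [|i s IH].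
  by under [X in intg _ X]eq_fun do rewrite big_nil expr0n; exact: intg_cst.
under [X in intg _ X]eq_fun do rewrite big_cons.
by apply: intg_sqrD => //; apply: measurable_sum.
Qed.

Lemma Lnorm2_lt (f : T -> R) (e : R) : intg mu (fun x => f x ^+ 2) -> 0 < e ->
  (Lnorm mu 2%:E (fun x => (f x)%:E) < e%:E)%E = (\int[mu]_x (f x ^+ 2) < e ^+ 2).
Proof.
have two0 : (2 : R) != 0 by rewrite pnatr_eq0.
move=> if2 e0; have := @poweR_Lnorm _ _ _ mu (fun x => (f x)%:E) 2 two0.
have -> : (\int[mu]_x (`|(f x)%:E| `^ 2) = (\int[mu]_x (f x ^+ 2)%R)%:E)%E.
  rewrite -Rintegral_EFin//; apply: eq_integral => x _.
  by rewrite /= powR_mulrn// real_normK// num_real.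
have := @Lnorm_ge0 _ _ _ mu 2%:E (fun x => (f x)%:E).
case: (Lnorm _ _ _) => [y| |] //= y0; last first.
  by rewrite (negbTE two0).
rewrite powR_mulrn// => -[<-].
by rewrite lte_fin ltr_sqr ?nnegrE// ltW.
Qed.

End square_integrability.

(** * Upper limits and right limits at 0 *)

Section limits.
Context {R : realType}.

Lemma limn_esup_le_near (u : (\bar R)^nat) (c : \bar R) :
  (\forall n \near \oo, u n <= c)%E -> (limn_esup u <= c)%E.
Proof.
move=> [N _ hN]; rewrite limn_esup_lim; apply: lime_le; first exact: is_cvg_esups.
exists N => // n /= Nn; apply: ge_ereal_sup => _ [k /= nk <-].
by apply: hN => /=; exact: leq_trans nk.
Qed.

Lemma limn_esup_ge0 (u : (\bar R)^nat) :
  (forall n, 0 <= u n)%E -> (0 <= limn_esup u)%E.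
Proof.
move=> u0; rewrite limn_esup_lim; apply: lime_ge; first exact: is_cvg_esups.
by apply: nearW => n; apply: ereal_sup_ge; exists (u n) => //; exists n => /=.
Qed.

Lemma cvge_at_right0 (u : R -> \bar R) : (forall x, 0 <= u x)%E ->
  (forall e : R, 0 < e -> exists2 d : R, 0 < d & forall x, 0 < x < d -> (u x <= e%:E)%E) ->
  u @ 0^'+ --> 0%E.
Proof.
move=> u0 h; have nearP e : 0 < e -> \forall x \near 0^'+, (u x <= e%:E)%E.
  move=> e0; have [d d0 hd] := h e e0.
  apply: filterS2 (nbhs_right_gt 0) (nbhs_right_lt d0) => x x0 xd.
  by apply: hd; rewrite x0.
apply/fine_cvgP; split.
  have := nearP 1 ltr01; apply: filterS => x ux.
  by rewrite ge0_fin_numE// (le_lt_trans ux)// ltry.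
apply/cvgrPdist_le => e e0; have := nearP e e0; apply: filterS => x ux.
rewrite sub0r normrN ger0_norm ?fine_ge0// -lee_fin fineK//.
by rewrite ge0_fin_numE// (le_lt_trans ux)// ltry.
Qed.

End limits.

(** * Piecewise linear goal functions *)

Section piecewise_linear.
Context {R : realType} {dO : measure_display} {Omega : measurableType dO}
  (P : probability Omega R) {m d : nat} (Z : nat -> {mfun Omega >-> Rvec R d})
  (Theta : set 'rV[R]_m) (Phi : R -> \bar R) {r : nat} {s : 'I_r -> nat}
  (T : 'rV[R]_m -> 'rV[R]_d) (L : forall i : 'I_r, 'I_(s i) -> 'rV[R]_d -> R)
  (a : forall i : 'I_r, 'I_(s i) -> R) (I : forall i : 'I_r, 'I_(s i) -> set R)
  (Lam : 'I_r -> 'rV[R]_d -> R) (b : 'I_r -> R) (G : 'rV[R]_m -> 'rV[R]_d -> R).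
Arguments L : clear implicits.
Arguments a : clear implicits.
Arguments I : clear implicits.
Hypothesis HPhi : Phi_admissible Phi.
Hypothesis HTheta_cpt : compact Theta.
Hypothesis HT : linear_map T.
Hypothesis HL : forall i l, linear_functional (L i l).
Hypothesis HI : forall i l, `]0, +oo[ `<=` I i l /\ I i l `<=` `[0, +oo[.
Hypothesis HLam : forall i, linear_functional (Lam i).
Hypothesis Hdisj : forall theta z, Theta theta -> forall i j : 'I_r, i != j ->
  PLind T L a I i theta z * PLind T L a I j theta z = 0.
Hypothesis Hsum1 : forall theta z, Theta theta ->
  \sum_(i < r) PLind T L a I i theta z = 1.
Hypothesis HG : forall theta z, Theta theta -> G theta z = PLform T L a I Lam b theta z.

Let mu : probability (Rvec R d) R := PZ P Z.
Let J := PLind T L a I.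

Lemma PLind_01 i theta z : J i theta z = 0 \/ J i theta z = 1.
Proof.
rewrite /J /PLind; elim/big_ind: _ => [|x y [] -> [] ->|l _]; first by right.
- by left; rewrite minxx.
- by left; apply/min_idPl.
- by left; apply/min_idPr.
- by right; rewrite minxx.
- by rewrite indicE; case: (_ \in _); [right|left].
Qed.

Lemma PLind_ge0 i theta z : 0 <= J i theta z.
Proof. by have [->|->] := PLind_01 i theta z. Qed.

Lemma PLind_le1 i theta z : J i theta z <= 1.
Proof. by have [->|->] := PLind_01 i theta z. Qed.

(** Zero-one factors with sum 1 leave some factor equal to 1, and vanishing products then force the
    others to be 0. [F] is quantified after [i], so that one index serves both the form of [G] and
    sums over the conjugate. *)
Lemma PLind_active theta z : Theta theta -> exists i, forall (F : 'I_r -> R),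
  \sum_(j < r) J j theta z * F j = F i.
Proof.
move=> th; have [i Ji] : exists i, J i theta z = 1.
  apply: contrapT => no; have := Hsum1 z th; rewrite big1.
    by move=> /esym/eqP; rewrite oner_eq0.
  by move=> i _; have [//|Ji] := PLind_01 i theta z; case: no; exists i.
exists i => F; rewrite (bigD1 i)//= Ji mul1r big1 ?addr0// => j ji.
by have := Hdisj z th ji; rewrite -/J Ji mulr1 => ->; rewrite mul0r.
Qed.

Lemma PLform_active theta z : Theta theta -> exists i,
  (forall (F : 'I_r -> R), \sum_(j < r) J j theta z * F j = F i) /\
  G theta z = Lam i z + (Lam i (T theta) + b i).
Proof.
move=> th; have [i hi] := PLind_active z th; exists i; split=> //.
by rewrite HG// /PLform hi linear_functionalD//; ring.
Qed.

(** Compactness bounds the linear part. The bound is taken at least 1 so that [C + t] is an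
    admissible positive shift in the square integrability assumption. *)
Lemma PLform_bounded : exists2 C : R, 1 <= C & forall i theta, Theta theta ->
  `|Lam i (T theta) + b i| <= C.
Proof.
have /choice[c hc] i : exists c : R, forall theta, Theta theta -> `|Lam i (T theta)| <= c.
  exact: (bounded_linear_functional (linear_functional_comp HT (HLam i)) HTheta_cpt).
exists (1 + \sum_(i < r) (`|c i| + `|b i|)).
  by rewrite lerDl sumr_ge0// => i _; rewrite addr_ge0.
move=> i theta th; rewrite (bigD1 i)//=.
have := hc i _ th; have := ler_norm (c i); have := ler_normD (Lam i (T theta)) (b i).
have : 0 <= \sum_(j < r | j != i) (`|c j| + `|b j|).
  by apply: sumr_ge0 => j _; rewrite addr_ge0.
lra.
Qed.

(** * Measurability of the goal function *)

Section measurability.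
Context {dX : measure_display} {X : measurableType dX}
  (u : X -> Rvec R m) (v : X -> Rvec R d).
Hypothesis mu_ : measurable_fun setT u.
Hypothesis mv : measurable_fun setT v.

(** Linearity turns the functional of a vector sum into a sum of real functions of [u x] and of
    [v x]. *)
Lemma measurable_shifted (f : 'rV[R]_d -> R) : linear_functional f ->
  measurable_fun setT (fun x => f (T (u x) + v x)).
Proof.
move=> lf.
rewrite (_ : (fun x => _) = fun x => (f \o T) (u x) + f (v x)); last first.
  by apply/funext => x; rewrite linear_functionalD.
apply: measurable_funD.
  apply: (measurableT_comp _ mu_); apply: measurable_linear_functional.
  exact: linear_functional_comp.
by apply: (measurableT_comp _ mv); exact: measurable_linear_functional.
Qed.

(** The inclusions leave only membership of 0 open, so there are just two such sets. *)
Lemma measurable_halfline i l : measurable (I i l).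
Proof.
have [h1 h2] := HI l.
have [I0|nI0] := pselect (I i l 0).
  suff -> : I i l = `[0, +oo[%classic by exact: measurable_itv.
  apply/seteqP; split => // x; rewrite /= in_itv/= andbT le_eqVlt => /orP[/eqP <-//|x0].
  by apply: h1; rewrite /= in_itv/= x0.
suff -> : I i l = `]0, +oo[%classic by exact: measurable_itv.
apply/seteqP; split => // x Ix; have := h2 x Ix; rewrite /= !in_itv/= !andbT.
by rewrite le_eqVlt => /orP[/eqP x0|//]; case: nI0; rewrite x0.
Qed.

Lemma measurable_PLind i : measurable_fun setT (fun x => J i (u x) (v x)).
Proof.
rewrite /J /PLind; elim: (index_enum _) => [|l ls IH].
  by rewrite [X in measurable_fun _ X](_ : _ = cst 1)//; apply/funext => x; rewrite big_nil.
under eq_fun do rewrite big_cons; apply: measurable_minr => //.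
apply: (measurableT_comp (measurable_indic (measurable_halfline l))).
by apply: measurable_funD => //; exact: measurable_shifted.
Qed.

(** Arbitrary measurable [u] and [v] cover both a fixed parameter and joint measurability. *)
Lemma measurable_PLform :
  measurable_fun setT (fun x => PLform T L a I Lam b (u x) (v x)).
Proof.
apply: measurable_sum => i; apply: measurable_funM; first exact: measurable_PLind.
by apply: measurable_funD => //; exact: measurable_shifted.
Qed.

End measurability.

Lemma measurable_G theta : Theta theta ->
  measurable_fun (setT : set (Rvec R d)) (G theta : Rvec R d -> R).
Proof.
move=> th; rewrite (_ : (G theta : Rvec R d -> R) = PLform T L a I Lam b theta).
  exact: (@measurable_PLform _ (Rvec R d) (cst theta) id).
by apply/funext => z; exact: HG.
Qed.

Lemma PL_A1 : (forall z, lsc_on Theta (fun theta => G theta z)) -> A1 Theta G.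
Proof.
move=> lsc; split=> //.
apply: (@eq_measurable_fun _ _ _ _ _
  (fun p : (Rvec R m * Rvec R d)%type => PLform T L a I Lam b p.1 p.2)).
  by move=> p /set_mem[th _]; rewrite HG.
apply: measurable_funTS.
exact: (@measurable_PLform _ (Rvec R m * Rvec R d)%type fst snd).
Qed.

Hypothesis HLamH : forall i, HPhiStar P Phi (fun w => Lam i (Z 0%N w)).

Let mLam i : measurable_fun (setT : set (Rvec R d)) (Lam i : Rvec R d -> R).
Proof. exact: measurable_linear_functional. Qed.

Let mphi_affine i (c t : R) :
  measurable_fun (setT : set (Rvec R d)) (fun z : Rvec R d => phistar Phi (c * `|Lam i z| + t)).
Proof.
apply: (measurableT_comp (measurable_phistar HPhi)); apply: measurable_funD => //.
by apply: measurable_funM => //; exact: measurableT_comp.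
Qed.

Lemma intg_phistar_scaled i (c : R) : 0 < c -> intg mu (fun z => phistar Phi (c * `|Lam i z|)).
Proof.
move=> c0; have [_ /(_ c c0) hi] := HLamH i.
have mphi : measurable_fun (setT : set (Rvec R d)) (fun z : Rvec R d => phistar Phi (c * `|Lam i z|)).
  by have := mphi_affine i c 0; under eq_fun do rewrite addr0.
apply: intg_distribution => //; apply: ge0_intg => //.
- exact: (measurableT_comp mphi).
- by move=> w; apply: (phistar_ge0 HPhi); rewrite mulr_ge0// ltW.
Qed.

Lemma intg_phistar_affine i (c t : R) : 0 < c -> 0 <= t ->
  intg mu (fun z => phistar Phi (c * `|Lam i z| + t)).
Proof.
move=> c0 t0.
have c20 : 0 < 2 * c by rewrite mulr_gt0.
have h := intgZ (1 / 2) (intgD (intg_phistar_scaled i c20) (intg_cst mu (phistar Phi (2 * t)))).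
apply: (le_intg _ h) => // z.
have y0 : 0 <= c * `|Lam i z| + t by rewrite addr_ge0// mulr_ge0// ltW.
rewrite ger0_norm; last exact: (phistar_ge0 HPhi).
apply: (le_trans (phistar_midpoint HPhi _ _)); rewrite /= mulrA; lra.
Qed.

Lemma intg_Lam i : intg mu (fun z => `|Lam i z|).
Proof.
have [p0 hp0] := phistar_affine_lower HPhi.
apply: (le_intg _ (intgD (intg_phistar_scaled i ltr01) (intg_cst mu p0))) => [|z].
  exact: measurableT_comp.
by rewrite normr_id mul1r; exact: hp0.
Qed.

Let le_sum_ord (F : 'I_r -> R) i : (forall j, 0 <= F j) -> F i <= \sum_(j < r) F j.
Proof. by move=> F0; rewrite (bigD1 i)//= lerDl sumr_ge0. Qed.

(** The active index depends on [theta] and [z], so the dominating function sums over all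
    indices. *)
Lemma PL_A2 : A2 P Z Theta G.
Proof.
have [C C1 hC] := PLform_bounded; have C0 : 0 <= C by rewrite (le_trans _ C1).
exists (fun z => \sum_(i < r) (`|Lam i z| + C)); split.
  by apply: intg_sum => i _; apply: intgD; [exact: intg_Lam|exact: intg_cst].
move=> theta z th; have [i [_ ->]] := PLform_active z th.
apply: le_trans (le_sum_ord i _) => [|j]; last by rewrite addr_ge0.
by apply: (le_trans (ler_normD _ _)); rewrite lerD2l; exact: hC.
Qed.

Lemma PL_A3 : A3 P Z Theta Phi G.
Proof.
have [C C1 hC] := PLform_bounded; have C0 : 0 <= C by rewrite (le_trans _ C1).
have Gle theta z : Theta theta -> exists i, `|G theta z| <= `|Lam i z| + C.
  move=> th; have [i [_ ->]] := PLform_active z th; exists i.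
  by apply: (le_trans (ler_normD _ _)); rewrite lerD2l; exact: hC.
split.
  move=> theta th; split.
    exact: (measurableT_comp (measurable_G th)).
  move=> c c0.
  have iS : intg mu (fun z => \sum_(i < r) phistar Phi (c * `|Lam i z| + c * C)).
    by apply: intg_sum => i _; apply: intg_phistar_affine => //; rewrite mulr_ge0// ltW.
  have := distribution_intg iS => /integrableP[_]; apply: le_lt_trans.
  have y0 (y : R) : 0 <= c * `|y| by rewrite mulr_ge0// ltW.
  apply: ge0_le_integral => //.
  - by move=> w _; rewrite lee_fin; exact: phistar_ge0.
  - apply/measurable_EFinP; apply: (measurableT_comp (measurable_phistar HPhi)).
    apply: measurable_funM => //; apply: measurableT_comp => //.
    exact: (measurableT_comp (measurable_G th)).
  - apply: measurableT_comp => //; apply/measurable_EFinP.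
    exact: (measurableT_comp (intg_measurable iS)).
  - move=> w _; rewrite /= lee_fin.
    have [i hi] := Gle theta (Z 0%N w) th.
    apply: le_trans (ler_norm _); apply: le_trans (le_sum_ord i _) => [|j].
      by apply: (phistar_nondecreasing HPhi); rewrite -mulrDr ler_pM2l.
    by apply: (phistar_ge0 HPhi); rewrite addr_ge0// mulr_ge0// ltW.
have [p0 p00 hp0] := phistar_lower HPhi.
exists (fun z => \sum_(i < r) (phistar Phi (1 * `|Lam i z| + C) + p0)); split.
  by apply: intg_sum => i _; apply: intgD; [exact: intg_phistar_affine|exact: intg_cst].
move=> theta z th; have [i hi] := Gle theta z th.
apply: le_trans (le_sum_ord i _) => [|j].
  by rewrite mul1r; exact: phistar_norm_le.
by rewrite addr_ge0//; apply: (phistar_ge0 HPhi); rewrite addr_ge0// mulr_ge0.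
Qed.

Hypothesis Hsq : forall i (eta : R), 0 < eta ->
  square_integrable P (fun w => phistar Phi (`|Lam i (Z 0%N w)| + eta)).

(** * Envelopes, square integrability and brackets of the class *)

Section envelope.
Context (C p0 : R).
Hypothesis C1 : 1 <= C.
Hypothesis hC : forall i theta, Theta theta -> `|Lam i (T theta) + b i| <= C.
Hypothesis p00 : 0 <= p0.
Hypothesis hp0 : forall y, - p0 <= phistar Phi y.

(** Dominates the conjugate on the i-th piece for all parameters in [Theta] and all shifts up to
    [t]; adding [p0] covers its negative values. *)
Definition envelope (t : R) (i : 'I_r) (z : 'rV[R]_d) : R :=
  phistar Phi (1 * `|Lam i z| + (C + t)) + p0.

Let C0 : 0 <= C. Proof. by rewrite (le_trans _ C1). Qed.

Lemma envelope_ge0 t i z : 0 <= t -> 0 <= envelope t i z.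
Proof.
move=> t0; rewrite addr_ge0//; apply: (phistar_ge0 HPhi).
by rewrite mul1r !addr_ge0.
Qed.

Lemma measurable_envelope t i :
  measurable_fun (setT : set (Rvec R d)) (envelope t i : Rvec R d -> R).
Proof. by apply: measurable_funD => //; exact: mphi_affine. Qed.

Lemma intg_envelope_sqr t i : 0 <= t -> intg mu (fun z => envelope t i z ^+ 2).
Proof.
move=> t0; apply: (@intg_sqrD _ _ _ mu
  (fun z : Rvec R d => phistar Phi (1 * `|Lam i z| + (C + t))) (cst p0)) => //.
- apply: intg_distribution; first by apply: measurable_funX; exact: mphi_affine.
  have Ct : 0 < C + t by rewrite ltr_wpDr// (lt_le_trans _ C1).
  have [_ h] := Hsq i Ct; rewrite /intg (_ : _ \o _ = fun w =>
    ((phistar Phi (`|Lam i (Z 0%N w)| + (C + t))) ^+ 2)%:E)//.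
  by apply/funext => w; rewrite /= mul1r.
- exact: (intg_cst mu (p0 ^+ 2)).
Qed.

Lemma intg_sum_envelope_sqr t : 0 <= t ->
  intg mu (fun z => (\sum_(i < r) envelope t i z) ^+ 2).
Proof.
move=> t0; apply: intg_sqr_sum => i; first exact: measurable_envelope.
exact: intg_envelope_sqr.
Qed.

Lemma phistar_shift_le t theta x i z : Theta theta -> `|x| <= t ->
  `|phistar Phi (Lam i z + (Lam i (T theta) + b i) + x)| <= envelope t i z.
Proof.
move=> th xt; rewrite /envelope mul1r; apply: phistar_norm_le => //.
apply: (le_trans (ler_normD _ _)); rewrite [leRHS]addrA lerD//.
by apply: (le_trans (ler_normD _ _)); rewrite lerD2l; exact: hC.
Qed.

Lemma phistar_G_le t theta x z : Theta theta -> `|x| <= t ->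
  `|phistar Phi (G theta z + x)| <= \sum_(i < r) envelope t i z.
Proof.
move=> th xt; have [i [_ ->]] := PLform_active z th.
apply: le_trans (le_sum_ord i _) => [|j]; first exact: phistar_shift_le.
by apply: envelope_ge0; rewrite (le_trans _ xt).
Qed.

Lemma measurable_phistar_G theta x : Theta theta ->
  measurable_fun (setT : set (Rvec R d)) (fun z : Rvec R d => phistar Phi (G theta z + x)).
Proof.
move=> th; apply: (measurableT_comp (measurable_phistar HPhi)).
by apply: measurable_funD => //; exact: measurable_G.
Qed.

Lemma PL_A4 : A4 P Z Theta Phi G.
Proof.
split.
  move=> theta x th; have mG := measurable_phistar_G x th; split.
    exact: (measurableT_comp mG).
  apply: (@distribution_intg _ _ _ P _ _ (Z 0%N) (fun z => phistar Phi (G theta z + x) ^+ 2)).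
  apply: (le_intg _ (intg_sum_envelope_sqr (normr_ge0 x))) => [|z].
    exact: measurable_funX.
  rewrite ger0_norm ?sqr_ge0// -[leLHS]real_normK ?num_real//.
  by rewrite lerXn2r ?nnegrE// ?phistar_G_le// sumr_ge0// => i _; exact: envelope_ge0.
move=> k; have k0 := ler0n R k.
have iS : intg mu (fun z => \sum_(i < r) envelope k%:R i z).
  apply: intg_sqr; last exact: intg_sum_envelope_sqr.
  by apply: measurable_sum => i; exact: measurable_envelope.
have iSZ := distribution_intg iS.
apply: (@le_lt_trans _ _ (\int[P]_w (\sum_(i < r) envelope k%:R i (Z 0%N w)))%:E); last exact: ltry.
apply: ge_ereal_sup => _ [[theta x] [/= th xk] <-].
have mG := measurable_phistar_G x th.
have iG : intg P (fun w => phistar Phi (G theta (Z 0%N w) + x)).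
  apply: (le_intg _ iSZ) => [|w]; first exact: (measurableT_comp mG).
  exact: phistar_G_le.
rewrite Rintegral_EFin// lee_fin; apply: Rintegral_le => // w.
by apply: le_trans (ler_norm _) (phistar_G_le _ th xk).
Qed.

Lemma dist_min_le (x y x' y' : R) :
  `|Num.min x y - Num.min x' y'| <= `|x - x'| + `|y - y'|.
Proof.
rewrite /Order.min; case: ltP => h1; case: ltP => h2; rewrite ler_norml;
  have := ler_norm (x - x'); have := ler_norm (y - y');
  have := ler_norm (x' - x); have := ler_norm (y' - y);
  rewrite (distrC x') (distrC y'); move=> *; apply/andP; split; lra.
Qed.

(** A minimum changes by at most the sum of the changes of its arguments. This separates the
    indicators, each of which is monotone in its own shift. *)
Lemma PLind_dist_le i theta theta' z : `|J i theta z - J i theta' z| <=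
  \sum_(l < s i) `|\1_(I i l) (L i l (T theta + z) + a i l)
                  - \1_(I i l) (L i l (T theta' + z) + a i l)|.
Proof.
rewrite /J /PLind; elim: (index_enum _) => [|l ls IH].
  by rewrite !big_nil subrr normr0.
by rewrite !big_cons; apply: (le_trans (dist_min_le _ _ _ _)); rewrite lerD2l.
Qed.

Context (k : nat).
Let k0 : 0 <= k%:R :> R := ler0n R k.
(** The summand 1 guarantees [W1], on which the end of the chain relies. *)
Let W z := 1 + \sum_(i < r) envelope k%:R i z.
Let inK : 'rV[R]_m * R -> Prop := inThetaK Theta k.
Let h := hfun Phi G.

Let mW : measurable_fun (setT : set (Rvec R d)) (W : Rvec R d -> R).
Proof.
by apply: measurable_funD => //; apply: measurable_sum => i; exact: measurable_envelope.
Qed.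

Let W1 z : 1 <= W z.
Proof. by rewrite lerDl sumr_ge0// => i _; exact: envelope_ge0. Qed.

Let W0 z : 0 <= W z. Proof. by rewrite (le_trans _ (W1 z)). Qed.

Let iW2 : intg mu (fun z => W z ^+ 2).
Proof.
apply: intg_sqrD => //; last exact: intg_sum_envelope_sqr.
  by apply: measurable_sum => i; exact: measurable_envelope.
exact: (intg_cst mu (1 ^+ 2)).
Qed.

Let mh g : inK g -> measurable_fun (setT : set (Rvec R d)) (h g : Rvec R d -> R).
Proof. by move=> [th _]; exact: measurable_phistar_G. Qed.

Let hW g z : inK g -> `|h g z| <= W z.
Proof.
by move=> [th xk]; apply: (le_trans (phistar_G_le z th xk)); rewrite lerDr.
Qed.

Let c i (g : 'rV[R]_m * R) := Lam i (T g.1) + b i + g.2.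

Let envelope_W i z : envelope k%:R i z <= W z.
Proof.
apply: le_trans (le_sum_ord i (fun j => envelope_ge0 j z k0)) _.
by rewrite lerDr.
Qed.

Let intg_envelope_W i : intg mu (fun z => envelope k%:R i z * W z).
Proof.
apply: (le_intg _ iW2) => [|z].
  by apply: measurable_funM => //; exact: measurable_envelope.
by rewrite ger0_norm ?mulr_ge0 ?envelope_ge0// expr2 ler_wpM2r.
Qed.

(** Adding [p0] leaves differences unchanged and makes the family nonnegative, as
    [bracketed_monotone] demands. *)
Lemma bracketed_phistar i : bracketed mu inK W (fun g g' z =>
  `|(phistar Phi (Lam i z + c i g) + p0) - (phistar Phi (Lam i z + c i g') + p0)|).
Proof.
apply: (@bracketed_monotone _ _ _ mu W mW W0 _ _ (c i)
  (fun t z => phistar Phi (Lam i z + t) + p0) (envelope k%:R i)).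
- by move=> t t' z tt'; rewrite lerD2r; apply: (phistar_nondecreasing HPhi); rewrite lerD2l.
- move=> g _; apply: measurable_funD => //.
  by apply: (measurableT_comp (measurable_phistar HPhi)); exact: measurable_funD.
- move=> g z [th xk]; apply/andP; split.
    by rewrite -lerBlDr sub0r.
  rewrite lerD2r mul1r; apply: (phistar_nondecreasing HPhi); apply: lerD.
    exact: ler_norm.
  by apply: lerD; [exact: le_trans (ler_norm _) (hC i th)|exact: le_trans (ler_norm _) xk].
- exact: intg_envelope_W.
Qed.

(** The envelope multiplies the indicator since it bounds the conjugate that stands beside the
    indicator in [h]. Monotonicity holds as [I i l] is closed upwards. *)
Lemma bracketed_indic i l : bracketed mu inK W (fun g g' z =>
  `|\1_(I i l) (L i l z + (L i l (T g.1) + a i l)) * envelope k%:R i z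
    - \1_(I i l) (L i l z + (L i l (T g'.1) + a i l)) * envelope k%:R i z|).
Proof.
apply: (@bracketed_monotone _ _ _ mu W mW W0 _ _ (fun g => L i l (T g.1) + a i l)
  (fun t z => \1_(I i l) (L i l z + t) * envelope k%:R i z) (envelope k%:R i)).
- move=> t t' z tt'; rewrite ler_wpM2r ?envelope_ge0// !indicE.
  have [/set_mem It|//] := boolP (L i l z + t \in I i l).
  have [h1 h2] := HI l.
  (* At the boundary point 0, which may belong to [I i l], a strictly larger shift leads into the
     open half-line. *)
  rewrite mem_set//; have := h2 _ It; rewrite /= in_itv/= andbT le_eqVlt => /orP[/eqP e|t0].
    have [<-//|ne] := eqVneq t t'; apply: h1; rewrite /= in_itv/= andbT e.
    by rewrite ltrD2l lt_neqAle ne.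
  by apply: h1; rewrite /= in_itv/= andbT (lt_le_trans t0)// lerD2l.
- move=> g _; apply: measurable_funM; last exact: measurable_envelope.
  apply: (measurableT_comp (measurable_indic (measurable_halfline l))).
  by apply: measurable_funD => //; exact: measurable_linear_functional.
- move=> g z _; have e0 := envelope_ge0 i z k0; rewrite indicE.
  by case: (_ \in _); rewrite ?mul1r ?mul0r ?e0 ?lexx.
- exact: intg_envelope_W.
Qed.

Lemma bracketed_hfun : bracketed mu inK W (fun g g' z => `|h g z - h g' z|).
Proof.
have := bracketed_sum (index_enum 'I_r) (fun i => bracketedD
  (bracketed_sum (index_enum 'I_(s i)) (fun l => bracketed_indic (l : 'I_(s i))))
  (bracketed_phistar i)).
apply: bracketed_le => g g' z gg g'g.
have hE g1 : inK g1 -> h g1 z = \sum_(i < r) J i g1.1 z * phistar Phi (Lam i z + c i g1).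
  move=> [th _]; have [i [hi Gi]] := PLform_active z th.
  by rewrite hi /h /hfun Gi /c; congr phistar; ring.
rewrite (hE _ gg) (hE _ g'g) -sumrB (le_trans (ler_norm_sum _ _ _))//.
apply: ler_sum => i _.
set f1 := phistar _ _; set f2 := phistar _ _.
have -> : f1 + p0 - (f2 + p0) = f1 - f2 by ring.
(* Product rule: the first term is bracketed through the indicators times the envelope, the second
   through the conjugate. The sum runs over all pieces, so [g] and [g'] may have different active
   indices. *)
have -> : J i g.1 z * f1 - J i g'.1 z * f2 =
  (J i g.1 z - J i g'.1 z) * f1 + J i g'.1 z * (f1 - f2) by ring.
apply: (le_trans (ler_normD _ _)); rewrite !normrM; apply: lerD; last first.
  by rewrite ger0_norm ?PLind_ge0// ler_piMl// PLind_le1.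
have f1e : `|f1| <= envelope k%:R i z.
  by case: gg => th xk; have := phistar_shift_le i z th xk; rewrite /f1 /c !addrA.
apply: (@le_trans _ _ (`|J i g.1 z - J i g'.1 z| * envelope k%:R i z)).
  by rewrite ler_wpM2l.
apply: (le_trans (ler_wpM2r (envelope_ge0 i z k0) (PLind_dist_le i g.1 g'.1 z))).
rewrite mulr_suml; apply: ler_sum => l _.
rewrite -mulrBl normrM (ger0_norm (envelope_ge0 i z k0)).
by rewrite !linear_functionalD// !addrA [L i l (T g.1) + _]addrC [L i l (T g'.1) + _]addrC.
Qed.

Lemma PL_totally_bounded (e : R) : 0 < e -> exists F : seq ('rV[R]_m * R),
  (forall g, g \in F -> inThetaK Theta k g) /\
  forall g, inThetaK Theta k g -> exists2 g', g' \in F & (dbarP2 P Z Phi G g g' < e%:E)%E.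
Proof.
move=> e0; have [K [B [t ht]]] := bracketed_net (0, 0) mW W0 hW bracketed_hfun.
pose q := (Num.truncn (2 / e ^+ 2)).+1.
have hq : 2 * 16 ^- q < e ^+ 2.
  rewrite ltr_pdivrMr ?exprn_gt0// mulrC -ltr_pdivrMr ?exprn_gt0//.
  rewrite (lt_le_trans (truncnS_gt _))// -natrX ler_nat; apply: ltnW; exact: ltn_expl.
have [_ hD rG hr] := ht q.
(* A cell without an index may carry a representative outside the index set; the filter removes
   these. *)
exists [seq g <- [seq net_repr (t q) i | i <- enum (net_cells (t q))] | `[< inThetaK Theta k g >]].
split; first by move=> g; rewrite mem_filter => /andP[/asboolP].
move=> g gg; have rg := rG g gg; exists (net_repr (t q) (net_label (t q) g)).
  by rewrite mem_filter; apply/andP; split; [exact/asboolP|rewrite map_f ?mem_enum].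
have [mD D0 iD bD] := hD (net_label (t q) g).
have [||i2 b2] := integral_sqr_le _ _ (hr g gg) iD bD.
- by apply: measurable_funB; exact: mh.
- move=> z; apply: (le_trans (ler_normB _ _)).
  by have := hW z gg; have := hW z rg; lra.
by rewrite /dbarP2 Lnorm2_lt//; exact: le_lt_trans hq.
Qed.

Hypothesis HZind : mutually_independent P (fun j => (Z j : Omega -> Rvec R d)).
Hypothesis HZid : identically_distributed P (fun j => (Z j : Omega -> Rvec R d)).

Let intg_h g : inK g -> intg mu (h g).
Proof.
move=> gg; apply: (le_intg (mh gg) (intg_sqr mW iW2)) => z; exact: hW.
Qed.

Lemma empproc_Gn n f w : (0 < n)%N -> intg mu f ->
  Num.sqrt n%:R * `|empproc P Z n f w| = `|Gn P Z n f w|.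
Proof.
move=> n0 iF; have s0 : 0 < Num.sqrt n%:R :> R by rewrite sqrtr_gt0 ltr0n.
have -> : Num.sqrt n%:R * `|empproc P Z n f w| = `|Num.sqrt n%:R * empproc P Z n f w|.
  by rewrite [RHS]normrM (ger0_norm (ltW s0)).
congr `|_|; rewrite /empproc /Gn mulrA; congr (_ * _).
  by rewrite -{2}(@sqr_sqrtr R n%:R)// expr2 invfM mulrA divff ?mul1r// gt_eqF.
apply: eq_bigr => j _; congr (_ - _).
exact: (Rintegral_comp HZid j iF).
Qed.

Lemma PL_equicontinuous (eps : R) : 0 < eps ->
  (fun delta : R => limn_esup (fun n : nat =>
     Pouter P [set w | exists g1 g2, inThetaK Theta k g1 /\ inThetaK Theta k g2 /\
                      (dbarP2 P Z Phi G g1 g2 < delta%:E)%E /\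
                      eps < Num.sqrt n%:R *
                            `|empproc P Z n (fun z => hfun Phi G g1 z - hfun Phi G g2 z) w|]))
     @ 0^'+ --> 0%E.
Proof.
move=> eps0; apply: cvge_at_right0.
  move=> delta; apply: limn_esup_ge0 => n.
  by apply: le_ereal_inf_tmp => _ [B [mB _] <-].
move=> eta eta0.
have [delta delta0 hdelta] :=
  bracketed_equicontinuous HZind HZid (0, 0) mW W1 iW2 mh hW bracketed_hfun eps0 eta0.
(* [delta] bounds the squared $L^2$ distance; for $0<x<1$ one has $x^2\le x<\delta$. *)
exists (Num.min 1 delta); first by rewrite lt_min ltr01.
move=> x /andP[x0]; rewrite lt_min => /andP[x1 xd].
apply: limn_esup_le_near; near=> n.
apply: outer_le_Pouter.
have n0 : (0 < n)%N by near: n; exists 1%N.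
have hn : outer_le P [set w | exists g1 g2, [/\ inK g1, inK g2,
      \int[mu]_x ((h g1 x - h g2 x) ^+ 2) <= delta &
      eps < `|Gn P Z n (fun x => h g1 x - h g2 x) w| ]] eta by near: n.
apply: outer_le_sub hn => // w [g1 [g2 [gg1 [gg2 [d12 big]]]]].
have i12 : intg mu (fun z => h g1 z - h g2 z) by apply: intgB; exact: intg_h.
exists g1, g2; split=> //; last by rewrite -empproc_Gn.
move: d12; rewrite /dbarP2 Lnorm2_lt//.
  move=> /ltW h12; apply: (le_trans h12); rewrite (le_trans _ (ltW xd))//.
  by rewrite expr2 ler_piMl// ltW.
apply: (le_intg _ (intgZ 4 iW2)) => [|z].
  by apply: measurable_funX; apply: measurable_funB; exact: mh.
rewrite ger0_norm ?sqr_ge0//.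
have := hW z gg1; have := hW z gg2; have := W0 z.
rewrite -[hfun Phi G g1 z]/(h g1 z) -[hfun Phi G g2 z]/(h g2 z).
move: (h g1 z) (h g2 z) (W z) => y1 y2 v v0; rewrite !ler_norml => /andP[? ?] /andP[? ?].
by nra.
Unshelve. all: by end_near. Qed.

End envelope.

Hypothesis HZind : mutually_independent P (fun j => (Z j : Omega -> Rvec R d)).
Hypothesis HZid : identically_distributed P (fun j => (Z j : Omega -> Rvec R d)).

Lemma PL_A4_A5 : A4 P Z Theta Phi G /\ A5 P Z Theta Phi G (dbarP2 P Z Phi G).
Proof.
have [C C1 hC] := PLform_bounded; have [p0 p00 hp0] := phistar_lower HPhi.
split; first exact: (PL_A4 C1 hC p00 hp0).
split=> [k e|eps k].
  exact: (PL_totally_bounded C1 hC p00 hp0).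
by apply: (PL_equicontinuous C1 hC p00 hp0).
Qed.

End piecewise_linear.

Unset Implicit Arguments.

Theorem theorem6p2 (R : realType) (dO : measure_display)
  (Omega : measurableType dO) (P : probability Omega R)
  (m d : nat) (Z : nat -> {mfun Omega >-> Rvec R d})
  (HZind : mutually_independent P (fun j => (Z j : Omega -> Rvec R d)))
  (HZid : identically_distributed P (fun j => (Z j : Omega -> Rvec R d)))
  (Theta : set 'rV[R]_m) (HTheta_cpt : compact Theta) (HTheta0 : Theta !=set0)
  (Phi : R -> \bar R) (HPhi : Phi_admissible Phi)
  (r : nat) (s : 'I_r -> nat) (Hs : forall i, (0 < s i)%N)
  (T : 'rV[R]_m -> 'rV[R]_d) (HT : linear_map T)
  (L : forall i : 'I_r, 'I_(s i) -> 'rV[R]_d -> R)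
  (HL : forall i l, linear_functional (L i l))
  (a : forall i : 'I_r, 'I_(s i) -> R)
  (I : forall i : 'I_r, 'I_(s i) -> set R)
  (HI : forall i l, `]0, +oo[ `<=` I i l /\ I i l `<=` `[0, +oo[)
  (Lam : 'I_r -> 'rV[R]_d -> R) (HLam : forall i, linear_functional (Lam i))
  (b : 'I_r -> R)
  (Hdisj : forall theta z, Theta theta -> forall i j : 'I_r, i != j ->
      PLind T L a I i theta z * PLind T L a I j theta z = 0)
  (Hsum1 : forall theta z, Theta theta ->
      \sum_(i < r) PLind T L a I i theta z = 1)
  (G : 'rV[R]_m -> 'rV[R]_d -> R)
  (HG : forall theta z, Theta theta -> G theta z = PLform T L a I Lam b theta z)
  (HGlsc : forall z, lsc_on Theta (fun theta => G theta z))
  (HLamH : forall i, HPhiStar P Phi (fun w => Lam i (Z 0%N w))) :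
  (A1 Theta G /\ A2 P Z Theta G /\ A3 P Z Theta Phi G) /\
  ((forall i (eta : R), 0 < eta ->
      square_integrable P (fun w => phistar Phi (`|Lam i (Z 0%N w)| + eta))) ->
   A4 P Z Theta Phi G /\ A5 P Z Theta Phi G (dbarP2 P Z Phi G)).
Proof.
split; last first.
  by move=> Hsq; exact: (PL_A4_A5 HPhi HTheta_cpt HT HL HI HLam Hdisj Hsum1 HG Hsq HZind HZid).
split; first exact: (PL_A1 HT HL HI HLam HG HGlsc).
split; first exact: (PL_A2 HPhi HTheta_cpt HT HLam Hdisj Hsum1 HG HLamH).
exact: (PL_A3 HPhi HTheta_cpt HT HL HI HLam Hdisj Hsum1 HG HLamH).
Qed.
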